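(* Let $\alpha,\nu,a\in\mathbb R$ with $(\nu,a)\neq(0,0)$, and let $\hat\xi=\big(\nu\sqrt{\tfrac{4\pi}{3}}\,e_{10},a\big)\in\hat{\mathfrak g}$. Let $l_0\ge1$, $0<|m_0|\le l_0$, and let $\hat\eta=(\eta_{l_0m_0}e_{l_0m_0}+\eta_{l_0\,-m_0}e_{l_0\,-m_0},0)\in\hat{\mathfrak g}$ be a unit vector, i.e. $$\ll\hat\eta,\hat\eta\gg_{\hat{\mathfrak g}}=2(-1)^{m_0}(\alpha^2+l_0(l_0+1))\eta_{l_0m_0}\eta_{l_0\,-m_0}=1.$$ Then the sectional curvature is $$\hat\kappa(\hat\xi,\hat\eta)=\frac{\ll\hat R(\hat\xi,\hat\eta)\hat\eta,\hat\xi\gg_{\hat{\mathfrak g}}}{\ll\hat\xi,\hat\xi\gg_{\hat{\mathfrak g}}}=\frac{m_0^2}{\big(\nu^2\frac{4\pi}{3}(\alpha^2+2)+a^2\big)(\alpha^2+l_0(l_0+1))^2}\Big[\frac{\nu^2}{4}(\alpha^2+2)^2+\frac{\nu a}{2}(\alpha^2+2)+\frac{a^2}{4}\Big].$$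
   Context: Use coordinates $(\lambda,\mu)$, $0\le\lambda\le2\pi$, $-1\le\mu\le1$, on the unit sphere $\mathbb S^2$ ($\mu$ = height, $\lambda$ = longitude). Put $\{f,g\}=\frac{\partial f}{\partial\lambda}\frac{\partial g}{\partial\mu}-\frac{\partial f}{\partial\mu}\frac{\partial g}{\partial\lambda}$ and $\langle f,g\rangle=\int_{-1}^1\int_0^{2\pi}fg\,d\lambda\,d\mu$ (complex bilinear, no conjugation). $\Delta$ is the Laplace–Beltrami operator of $\mathbb S^2$, and $\Delta_\theta=\alpha^2-\Delta$. $\mathfrak g$ is the Lie algebra of elements written $\mathrm{sgrad} f$, where $f$ is a function on $\mathbb S^2$ and $f\mapsto\mathrm{sgrad} f$ is a linear isomorphism (functions are taken modulo constants if $\alpha=0$), with $[\mathrm{sgrad} f,\mathrm{sgrad} g]=\mathrm{sgrad}\{f,g\}$ and $\ll\mathrm{sgrad} f,\mathrm{sgrad} g\gg_{\mathfrak g}=\langle\Delta_\theta f,g\rangle$; everything is extended complex-bilinearly to complex-valued functions. The central extension $\hat{\mathfrak g}=\mathfrak g\ltimes_\Omega\mathbb R$ has bracket $[(u,a),(v,b)]=([u,v],\Omega(u,v))$ and inner product $\ll(u,a),(v,b)\gg_{\hat{\mathfrak g}}=\ll u,v\gg_{\mathfrak g}+ab$, where $\Omega(\mathrm{sgrad} f,\mathrm{sgrad} g)=\langle\mu,\{f,g\}\rangle$. The connection $\hat\nabla$ on $\hat{\mathfrak g}$ is the bilinear map determined by $2\ll\hat\nabla_XY,Z\gg=\ll[X,Y],Z\gg-\ll[Y,Z],X\gg+\ll[Z,X],Y\gg$,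 and $\hat R(X,Y)Z=\hat\nabla_X\hat\nabla_YZ-\hat\nabla_Y\hat\nabla_XZ-\hat\nabla_{[X,Y]}Z$. $Y_{lm}$, $|m|\le l$, are the standard complex spherical harmonics on $\mathbb S^2$ with Condon–Shortley phase: $\Delta Y_{lm}=-l(l+1)Y_{lm}$, $\overline{Y_{lm}}=(-1)^mY_{l\,-m}$, $\langle Y_{l_1m_1},Y_{l_2m_2}\rangle=(-1)^{m_1}\delta^{l_1}_{l_2}\delta^{m_1}_{-m_2}$, $Y_{10}=\sqrt{3/4\pi}\,\mu$; i.e. $Y_{lm}=C_l^mP_l^{|m|}(\mu)e^{im\lambda}$ with $P_l^{|m|}(\mu)=\frac{(1-\mu^2)^{|m|/2}}{2^ll!}\frac{d^{l+|m|}}{d\mu^{l+|m|}}(\mu^2-1)^l$, $C_l^m=\epsilon_m\sqrt{\frac{2l+1}{4\pi}\frac{(l-|m|)!}{(l+|m|)!}}$, $\epsilon_m=(-1)^m$ for $m\ge0$ and $\epsilon_m=1$ for $m<0$. Write $e_{lm}=\mathrm{sgrad}(Y_{lm})$. *)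

(* Defs.v *)
From Stdlib Require Import Reals ZArith.
From Coquelicot Require Export Coquelicot.

Open Scope R_scope.

(* A function on the unit sphere is given by its values [f lambda mu] at
   longitude [lambda] and height [mu].  Only the values for -1 < mu < 1 carry
   information: at the poles the coordinates are singular, and a continuous
   function is determined there by its values elsewhere. *)
Definition sfun : Type := R -> R -> C.

Definition sfun_eq (f g : sfun) : Prop :=
  forall lambda mu, -1 < mu < 1 -> f lambda mu = g lambda mu.

Definition sfun_plus (f g : sfun) : sfun :=
  fun lambda mu => (f lambda mu + g lambda mu)%C.
Definition sfun_mult (f g : sfun) : sfun :=
  fun lambda mu => (f lambda mu * g lambda mu)%C.
Definition sfun_scal (c : C) (f : sfun) : sfun :=
  fun lambda mu => (c * f lambda mu)%C.
Definition sfun_minus (f g : sfun) : sfun :=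
  fun lambda mu => (f lambda mu - g lambda mu)%C.

Definition height : sfun := fun lambda mu => RtoC mu.

Definition D1 (F : R -> R -> R -> R) : R -> R -> R -> R :=
  fun x y z => Derive (fun t => F t y z) x.
Definition D2 (F : R -> R -> R -> R) : R -> R -> R -> R :=
  fun x y z => Derive (fun t => F x t z) y.
Definition D3 (F : R -> R -> R -> R) : R -> R -> R -> R :=
  fun x y z => Derive (fun t => F x y t) z.

Fixpoint Ck3 (k : nat) (F : R -> R -> R -> R) : Prop :=
  match k with
  | O => forall p : R * R * R,
      continuous (fun q : R * R * R => F (fst (fst q)) (snd (fst q)) (snd q)) p
  | S k' =>
      (forall x y z,
         ex_derive (fun t => F t y z) x /\
         ex_derive (fun t => F x t z) y /\
         ex_derive (fun t => F x y t) z) /\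
      Ck3 k' (D1 F) /\ Ck3 k' (D2 F) /\ Ck3 k' (D3 F)
  end.

Definition smooth3 (F : R -> R -> R -> R) : Prop := forall k : nat, Ck3 k F.

(* Smooth functions on the embedded unit sphere are the restrictions of smooth
   functions on R^3. *)
Definition smooth_on_sphere (f : sfun) : Prop :=
  exists F1 F2 : R -> R -> R -> R,
    smooth3 F1 /\ smooth3 F2 /\
    forall lambda mu, -1 < mu < 1 ->
      let r := sqrt (1 - mu ^ 2) in
      f lambda mu = (F1 (r * cos lambda) (r * sin lambda) mu,
                     F2 (r * cos lambda) (r * sin lambda) mu).

Definition CDerive (f : R -> C) (t : R) : C :=
  (Derive (fun s => Re (f s)) t, Derive (fun s => Im (f s)) t).
Definition CRInt (f : R -> C) (a b : R) : C :=
  (RInt (fun s => Re (f s)) a b, RInt (fun s => Im (f s)) a b).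

Definition d_lambda (f : sfun) : sfun :=
  fun lambda mu => CDerive (fun t => f t mu) lambda.
Definition d_mu (f : sfun) : sfun :=
  fun lambda mu => CDerive (fun t => f lambda t) mu.

Definition poisson (f g : sfun) : sfun :=
  sfun_minus (sfun_mult (d_lambda f) (d_mu g)) (sfun_mult (d_mu f) (d_lambda g)).

(* No conjugation: this pairing is complex bilinear. *)
Definition pairing (f g : sfun) : C :=
  CRInt (fun mu => CRInt (fun lambda => (f lambda mu * g lambda mu)%C) 0 (2 * PI))
        (-1) 1.

(* The metric of the sphere is
   (1 - mu^2) dlambda^2 + (1 - mu^2)^(-1) dmu^2, of determinant 1, so
   Delta f = d_mu ((1 - mu^2) d_mu f) + (1 - mu^2)^(-1) d_lambda^2 f. *)
Definition Laplace_Beltrami (f : sfun) : sfun :=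
  sfun_plus
    (d_mu (fun lambda mu => (RtoC (1 - mu ^ 2) * d_mu f lambda mu)%C))
    (fun lambda mu => (RtoC (/ (1 - mu ^ 2)) * d_lambda (d_lambda f) lambda mu)%C).

Definition Delta_theta (alpha : R) (f : sfun) : sfun :=
  sfun_minus (sfun_scal (RtoC (alpha ^ 2)) f) (Laplace_Beltrami f).

Definition Legendre_assoc (l k : nat) (mu : R) : R :=
  sqrt (1 - mu ^ 2) ^ k / (2 ^ l * INR (fact l))
  * Derive_n (fun x => (x ^ 2 - 1) ^ l) (l + k) mu.

Definition CS_sign (m : Z) : R := if (0 <=? m)%Z then powerRZ (-1) m else 1.

Definition Y_coef (l : nat) (m : Z) : R :=
  CS_sign m *
  sqrt ((2 * INR l + 1) / (4 * PI)
        * (INR (fact (l - Z.abs_nat m)) / INR (fact (l + Z.abs_nat m)))).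

(* Meant for |m| <= l. *)
Definition Y (l : nat) (m : Z) : sfun :=
  fun lambda mu =>
    (RtoC (Y_coef l m * Legendre_assoc l (Z.abs_nat m) mu)
     * (cos (IZR m * lambda), sin (IZR m * lambda)))%C.

(* The complexification of the Lie algebra, with the bracket, the inner product
   and the cocycle extended complex-bilinearly.  [sgrad] is total, but only its
   values at smooth functions are constrained.  Surjectivity and the kernel say
   that it is an isomorphism from the smooth functions, taken modulo constants
   if alpha = 0; they determine the structure up to isomorphism. *)
Record sgrad_algebra (alpha : R) : Type := {
  sg_space :> ModuleSpace C_Ring;
  sgrad : sfun -> sg_space;
  sg_bracket : sg_space -> sg_space -> sg_space;
  sg_inner : sg_space -> sg_space -> C;
  sg_Omega : sg_space -> sg_space -> C;
  sgrad_plus : forall f g, smooth_on_sphere f -> smooth_on_sphere g ->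
    sgrad (sfun_plus f g) = plus (sgrad f) (sgrad g);
  sgrad_scal : forall (c : C) f, smooth_on_sphere f ->
    sgrad (sfun_scal c f) = scal c (sgrad f);
  sgrad_surj : forall u, exists f, smooth_on_sphere f /\ sgrad f = u;
  sgrad_ker : forall f, smooth_on_sphere f ->
    (sgrad f = zero <->
     exists c : C, (alpha <> 0 -> c = RtoC 0) /\ sfun_eq f (fun _ _ => c));
  sg_bracketE : forall f g, smooth_on_sphere f -> smooth_on_sphere g ->
    sg_bracket (sgrad f) (sgrad g) = sgrad (poisson f g);
  sg_innerE : forall f g, smooth_on_sphere f -> smooth_on_sphere g ->
    sg_inner (sgrad f) (sgrad g) = pairing (Delta_theta alpha f) g;
  sg_OmegaE : forall f g, smooth_on_sphere f -> smooth_on_sphere g ->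
    sg_Omega (sgrad f) (sgrad g) = pairing height (poisson f g)
}.

Arguments sgrad {alpha} _ _.
Arguments sg_bracket {alpha} _ _ _.
Arguments sg_inner {alpha} _ _ _.
Arguments sg_Omega {alpha} _ _ _.

Definition esph {alpha : R} (G : sgrad_algebra alpha) (l : nat) (m : Z) : G :=
  sgrad G (Y l m).

Definition hat {alpha : R} (G : sgrad_algebra alpha) : ModuleSpace C_Ring :=
  prod_ModuleSpace C_Ring G (Ring_ModuleSpace C_Ring).

Definition hat_bracket {alpha : R} (G : sgrad_algebra alpha) (X X' : hat G) : hat G :=
  (sg_bracket G (fst X) (fst X'), sg_Omega G (fst X) (fst X')).

Definition hat_inner {alpha : R} (G : sgrad_algebra alpha) (X X' : hat G) : C :=
  (sg_inner G (fst X) (fst X') + snd X * snd X')%C.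

Definition bilinear_map {E : ModuleSpace C_Ring} (B : E -> E -> E) : Prop :=
  (forall x x' y, B (plus x x') y = plus (B x y) (B x' y)) /\
  (forall x y y', B x (plus y y') = plus (B x y) (B x y')) /\
  (forall (c : C) x y, B (scal c x) y = scal c (B x y)) /\
  (forall (c : C) x y, B x (scal c y) = scal c (B x y)).

Definition hat_connection {alpha : R} (G : sgrad_algebra alpha)
    (nabla : hat G -> hat G -> hat G) : Prop :=
  bilinear_map nabla /\
  forall X X' Z : hat G,
    (RtoC 2 * hat_inner G (nabla X X') Z)%C =
    (hat_inner G (hat_bracket G X X') Z
     - hat_inner G (hat_bracket G X' Z) X
     + hat_inner G (hat_bracket G Z X) X')%C.

Definition curvature {alpha : R} (G : sgrad_algebra alpha)
    (nabla : hat G -> hat G -> hat G) (X X' Z : hat G) : hat G :=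
  minus (minus (nabla X (nabla X' Z)) (nabla X' (nabla X Z)))
        (nabla (hat_bracket G X X') Z).

Definition sectional {alpha : R} (G : sgrad_algebra alpha)
    (nabla : hat G -> hat G -> hat G) (X X' : hat G) : C :=
  (hat_inner G (curvature G nabla X X' X') X
   / (hat_inner G X X * hat_inner G X' X' - hat_inner G X X' * hat_inner G X X'))%C.

(* Main.v *)
Require Import Defs.
From Stdlib Require Import Reals ZArith.
From Coquelicot Require Import Coquelicot.
From Stdlib Require Import Lra Lia FunctionalExtensionality.

(** Write [D] for the derivative along parallels, so that [poisson u height] is [D u].
    On smooth functions the pairing is invariant, <h,{f,g}> = <{h,f},g>
    ([pairing_poisson]), because the integral of a Poisson bracket over the
    sphere vanishes ([sphere_int_rpoisson]); and since the Laplacian is the sum of the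
    squares of the brackets with the three Cartesian coordinates
    ([Laplace_poisson]), [Delta_theta] is symmetric for the pairing
    ([pairing_Delta_theta]).

    Let xi = (sgrad (nu mu), a) and eta = (sgrad f, 0), where f and D f are
    eigenfunctions of [Delta_theta] for the same eigenvalue c, and put
    b = alpha^2 + 2, k = nu b + a, N = <D f, D f>.  The bracket of xi with
    (sgrad u, s) is (-nu sgrad (D u), 0), and <<[(sgrad u, s), (sgrad v, t)], xi>>
    = k <u, D v>.  The curvature
    consists of three terms <<nabla X Y, xi>>, each of which the Koszul formula
    expresses through brackets and inner products.  No inverse of the inertia
    operator and no formula for the connection is needed: nabla eta eta drops
    out, as <<nabla xi W, xi>> = 0 for every W, and of nabla xi eta = (sgrad v, s)
    only the number <v, D f> enters, which is 1/c times the inner product of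
    nabla xi eta with (sgrad (D f), 0), hence again given by Koszul's formula.  The
    terms are 0, - k (k - 2 nu c) N / (4 c) and - nu k N / 2, and the first minus
    the other two is k^2 N / (4 c) ([curvature_xi_eta]).

    It remains to compute with spherical harmonics.  The general Leibniz rule,
    applied to the identity (x^2 - 1) u' = 2 l x u for u = (x^2 - 1)^l, gives the
    Legendre equation, hence the eigenvalues ([Laplace_Y]); it also gives a
    recursion in the order for the norms of the Legendre functions, which at
    the top order reduce to the integral of (1 - x^2)^l ([Legendre_normE]).  Hence
    <Y_lm, Y_l-m> = (-1)^m, and N = m^2 <f, f> = m^2 / c for a unit vector. *)

(** * Smooth functions on three-space *)

(* Extensionality for functions of three variables. *)
Ltac fext := do 3 (apply functional_extensionality; intro).

Lemma smooth3_D F : smooth3 F -> smooth3 (D1 F) /\ smooth3 (D2 F) /\ smooth3 (D3 F).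
Proof.
intros H; repeat split; intros k; destruct (H (S k)) as (_ & A & B & C); assumption.
Qed.

Lemma smooth3_ex F x y z : smooth3 F ->
  ex_derive (fun t => F t y z) x /\ ex_derive (fun t => F x t z) y /\
  ex_derive (fun t => F x y t) z.
Proof. intros H; destruct (H 1%nat) as (A & _); apply A. Qed.

Lemma smooth3_const c : smooth3 (fun _ _ _ => c).
Proof.
intros k; revert c; induction k as [|k IH]; intros c.
- intros p; apply continuous_const.
- split; [|repeat split].
  + intros; repeat split; apply ex_derive_const.
  + replace (D1 (fun _ _ _ => c)) with (fun _ _ _ : R => 0); [apply IH|].
    fext; unfold D1; now rewrite Derive_const.
  + replace (D2 (fun _ _ _ => c)) with (fun _ _ _ : R => 0); [apply IH|].
    fext; unfold D2; now rewrite Derive_const.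
  + replace (D3 (fun _ _ _ => c)) with (fun _ _ _ : R => 0); [apply IH|].
    fext; unfold D3; now rewrite Derive_const.
Qed.

Lemma smooth3_X : smooth3 (fun x _ _ => x).
Proof.
intros [|k].
- intros p; apply (continuous_comp (fun q : R*R*R => fst q) fst); apply continuous_fst.
- split; [|repeat split].
  + intros; split; [apply ex_derive_id|split; apply ex_derive_const].
  + replace (D1 _) with (fun _ _ _ : R => 1); [apply smooth3_const|].
    fext; unfold D1; now rewrite Derive_id.
  + replace (D2 _) with (fun _ _ _ : R => 0); [apply smooth3_const|].
    fext; unfold D2; now rewrite Derive_const.
  + replace (D3 _) with (fun _ _ _ : R => 0); [apply smooth3_const|].
    fext; unfold D3; now rewrite Derive_const.
Qed.

Lemma smooth3_Y : smooth3 (fun _ y _ => y).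
Proof.
intros [|k].
- intros p; apply (continuous_comp (fun q : R*R*R => fst q) snd);
    [apply continuous_fst|apply continuous_snd].
- split; [|repeat split].
  + intros; split; [|split]; [apply ex_derive_const|apply ex_derive_id|apply ex_derive_const].
  + replace (D1 _) with (fun _ _ _ : R => 0); [apply smooth3_const|].
    fext; unfold D1; now rewrite Derive_const.
  + replace (D2 _) with (fun _ _ _ : R => 1); [apply smooth3_const|].
    fext; unfold D2; now rewrite Derive_id.
  + replace (D3 _) with (fun _ _ _ : R => 0); [apply smooth3_const|].
    fext; unfold D3; now rewrite Derive_const.
Qed.

(** The library iterates derivatives from the outside; this peels off the
    innermost one. *)
Lemma Derive_n_Derive (f : R -> R) n x : Derive_n (Derive f) n x = Derive_n f (S n) x.
Proof.
revert x; induction n as [|n IH]; intros x; [easy|].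
simpl; apply Derive_ext; exact IH.
Qed.

(** A smooth function of the third coordinate alone. *)
Lemma smooth3_Zfun (phi : R -> R) :
  (forall n x, ex_derive_n phi n x) -> smooth3 (fun _ _ z => phi z).
Proof.
intros H k; revert phi H; induction k as [|k IH]; intros phi H.
- intros p; apply (continuous_comp (fun q : R*R*R => snd q) phi); [apply continuous_snd|].
  exact (@ex_derive_continuous R_AbsRing R_NormedModule phi _ (H 1%nat _)).
- split; [|repeat split].
  + intros; split; [|split]; [apply ex_derive_const|apply ex_derive_const|apply (H 1%nat)].
  + replace (D1 _) with (fun _ _ _ : R => 0); [apply smooth3_const|].
    fext; unfold D1; now rewrite Derive_const.
  + replace (D2 _) with (fun _ _ _ : R => 0); [apply smooth3_const|].
    fext; unfold D2; now rewrite Derive_const.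
  + apply (IH (Derive phi)); intros n x.
    destruct n as [|n]; [exact I|].
    generalize (H (S (S n)) x); simpl; apply ex_derive_ext; intros t.
    now rewrite Derive_n_Derive.
Qed.

Lemma Ck3_plus k F G : Ck3 k F -> Ck3 k G -> Ck3 k (fun x y z => F x y z + G x y z).
Proof.
revert F G; induction k as [|k IH]; intros F G HF HG.
- intros p; apply (@continuous_plus (prod_UniformSpace (prod_UniformSpace R_UniformSpace
    R_UniformSpace) R_UniformSpace) _ R_NormedModule); [apply HF|apply HG].
- destruct HF as (eF & F1 & F2 & F3), HG as (eG & G1 & G2 & G3).
  split; [|repeat split].
  + intros x y z; destruct (eF x y z) as (?&?&?), (eG x y z) as (?&?&?).
    repeat split; apply (@ex_derive_plus R_AbsRing R_NormedModule); assumption.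
  + replace (D1 _) with (fun x y z => D1 F x y z + D1 G x y z); [now apply IH|].
    fext; symmetry; exact (Derive_plus _ _ _ (proj1 (eF x x0 x1)) (proj1 (eG x x0 x1))).
  + replace (D2 _) with (fun x y z => D2 F x y z + D2 G x y z); [now apply IH|].
    fext; symmetry; exact (Derive_plus _ _ _ (proj1 (proj2 (eF x x0 x1))) (proj1 (proj2 (eG x x0 x1)))).
  + replace (D3 _) with (fun x y z => D3 F x y z + D3 G x y z); [now apply IH|].
    fext; symmetry; exact (Derive_plus _ _ _ (proj2 (proj2 (eF x x0 x1))) (proj2 (proj2 (eG x x0 x1)))).
Qed.

Lemma smooth3_plus F G : smooth3 F -> smooth3 G -> smooth3 (fun x y z => F x y z + G x y z).
Proof. intros HF HG k; now apply Ck3_plus. Qed.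

(** The product rule for a partial derivative involves the factors themselves,
    so the induction on the order needs both factors to be smooth to all orders. *)
Lemma smooth3_mult F G : smooth3 F -> smooth3 G -> smooth3 (fun x y z => F x y z * G x y z).
Proof.
intros HF HG k; revert F G HF HG; induction k as [|k IH]; intros F G HF HG.
- intros p; apply (@continuous_mult (prod_UniformSpace (prod_UniformSpace R_UniformSpace
    R_UniformSpace) R_UniformSpace) R_AbsRing); [apply (HF O)|apply (HG O)].
- pose proof (fun x y z => smooth3_ex F x y z HF) as eF.
  pose proof (fun x y z => smooth3_ex G x y z HG) as eG.
  destruct (smooth3_D F HF) as (F1 & F2 & F3), (smooth3_D G HG) as (G1 & G2 & G3).
  split; [|repeat split].
  + intros x y z; destruct (eF x y z) as (?&?&?), (eG x y z) as (?&?&?).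
    repeat split; apply ex_derive_mult; assumption.
  + replace (D1 _) with (fun x y z => D1 F x y z * G x y z + F x y z * D1 G x y z);
      [apply Ck3_plus; now apply IH|].
    fext; symmetry; exact (Derive_mult _ _ _ (proj1 (eF x x0 x1)) (proj1 (eG x x0 x1))).
  + replace (D2 _) with (fun x y z => D2 F x y z * G x y z + F x y z * D2 G x y z);
      [apply Ck3_plus; now apply IH|].
    fext; symmetry; exact (Derive_mult _ _ _ (proj1 (proj2 (eF x x0 x1))) (proj1 (proj2 (eG x x0 x1)))).
  + replace (D3 _) with (fun x y z => D3 F x y z * G x y z + F x y z * D3 G x y z);
      [apply Ck3_plus; now apply IH|].
    fext; symmetry; exact (Derive_mult _ _ _ (proj2 (proj2 (eF x x0 x1))) (proj2 (proj2 (eG x x0 x1)))).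
Qed.

(** Mean value theorem, for increments of either sign. *)
Lemma MVT_all (f : R -> R) a b : (forall t, ex_derive f t) ->
  exists c, Rabs (c - a) <= Rabs (b - a) /\ f b - f a = Derive f c * (b - a).
Proof.
intros H.
destruct (MVT_gen f a b (Derive f)) as (c & Hc & E).
- intros x _; now apply Derive_correct.
- intros x _; apply continuity_pt_filterlim.
  exact (@ex_derive_continuous R_AbsRing R_NormedModule f x (H x)).
- exists c; split; [|exact E].
  revert Hc; unfold Rmin, Rmax; destruct (Rle_dec a b); intros Hc;
    unfold Rabs; destruct (Rcase_abs (c - a)), (Rcase_abs (b - a)); lra.
Qed.

Lemma Ck3_0_eps F x y z (eps : posreal) : Ck3 0 F ->
  exists d : posreal, forall u v w, Rabs (u - x) < d -> Rabs (v - y) < d -> Rabs (w - z) < d ->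
    Rabs (F u v w - F x y z) < eps.
Proof.
intros H; specialize (H (x, y, z)).
destruct (proj1 (filterlim_locally _ _) H eps) as (d & Hd).
exists d; intros u v w Hu Hv Hw.
apply (Hd (u, v, w)); repeat split; assumption.
Qed.

(** The increments of a differentiable curve are linear up to a small relative
    error. *)
Lemma is_derive_incr (x : R -> R) t dx : is_derive x t dx -> forall eps : posreal,
  locally t (fun s => Rabs (x s - x t - (s - t) * dx) <= eps * Rabs (s - t)).
Proof.
intros [_ H] eps. exact (H t (fun P HP => HP) eps).
Qed.

(** The chain rule along a curve. The increment of the function is split into
    three increments along the axes, to which the mean value theorem applies. *)
Lemma is_derive_comp3 F (x y z : R -> R) t dx dy dz : smooth3 F ->
  is_derive x t dx -> is_derive y t dy -> is_derive z t dz ->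
  is_derive (fun s => F (x s) (y s) (z s)) t
    (dx * D1 F (x t) (y t) (z t) + dy * D2 F (x t) (y t) (z t) + dz * D3 F (x t) (y t) (z t)).
Proof.
intros HF Hx Hy Hz.
destruct (smooth3_D F HF) as (F1 & F2 & F3).
set (a1 := D1 F (x t) (y t) (z t)); set (a2 := D2 F (x t) (y t) (z t));
set (a3 := D3 F (x t) (y t) (z t)).
split; [apply is_linear_scal_l|].
intros t' Ht' eps.
assert (E : t = t') by (apply (is_filter_lim_locally_unique t t'); exact Ht'); subst t'.
(* Up to the error [e] on all data, the remainder is at most [e * K] times the
   increment of the parameter. *)
set (K := (Rabs dx + Rabs dy + Rabs dz + 3) + (Rabs a1 + Rabs a2 + Rabs a3)).
assert (K1 : 1 <= K) by (unfold K; generalize (Rabs_pos dx) (Rabs_pos dy) (Rabs_pos dz)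
  (Rabs_pos a1) (Rabs_pos a2) (Rabs_pos a3); lra).
assert (He : 0 < Rmin 1 (eps / K)).
{ apply Rmin_case; [lra|]. apply Rdiv_lt_0_compat; [apply eps|lra]. }
set (e := mkposreal _ He).
assert (e1 : e <= 1) by apply Rmin_l.
assert (eK : e * K <= eps).
{ apply Rle_trans with (eps / K * K); [|right; field; lra].
  apply Rmult_le_compat_r; [lra|apply Rmin_r]. }
destruct (Ck3_0_eps _ (x t) (y t) (z t) e (F1 O)) as (d1 & C1).
destruct (Ck3_0_eps _ (x t) (y t) (z t) e (F2 O)) as (d2 & C2).
destruct (Ck3_0_eps _ (x t) (y t) (z t) e (F3 O)) as (d3 & C3).
assert (Hd : 0 < Rmin d1 (Rmin d2 d3)).
{ repeat apply Rmin_case; apply cond_pos. }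
set (d := mkposreal _ Hd).
assert (D1' : d <= d1) by apply Rmin_l.
assert (D2' : d <= d2) by (eapply Rle_trans; [apply Rmin_r|apply Rmin_l]).
assert (D3' : d <= d3) by (eapply Rle_trans; [apply Rmin_r|apply Rmin_r]).
assert (cont : forall (u : R -> R) du, is_derive u t du ->
  locally t (fun s => Rabs (u s - u t) < d)).
{ intros u du Hu.
  assert (Cu : continuous u t) by (apply (@ex_derive_continuous R_AbsRing R_NormedModule); now exists du).
  exact (proj1 (filterlim_locally _ _) Cu d). }
generalize (cont x dx Hx) (cont y dy Hy) (cont z dz Hz)
  (is_derive_incr x t dx Hx e) (is_derive_incr y t dy Hy e) (is_derive_incr z t dz Hz e).
intros Lx Ly Lz Ix Iy Iz.
generalize (filter_and _ _ Lx (filter_and _ _ Ly (filter_and _ _ Lz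
  (filter_and _ _ Ix (filter_and _ _ Iy Iz))))).
apply filter_imp; clear Lx Ly Lz Ix Iy Iz cont.
intros s (Lx & Ly & Lz & Ix & Iy & Iz).
change (Rabs (F (x s) (y s) (z s) - F (x t) (y t) (z t) -
  (s - t) * (dx * a1 + dy * a2 + dz * a3)) <= eps * Rabs (s - t)).
destruct (MVT_all (fun u => F u (y s) (z s)) (x t) (x s)) as (c1 & B1 & E1);
  [intros u; exact (proj1 (smooth3_ex F u _ _ HF))|].
destruct (MVT_all (fun u => F (x t) u (z s)) (y t) (y s)) as (c2 & B2 & E2);
  [intros u; exact (proj1 (proj2 (smooth3_ex F _ u _ HF)))|].
destruct (MVT_all (fun u => F (x t) (y t) u) (z t) (z s)) as (c3 & B3 & E3);
  [intros u; exact (proj2 (proj2 (smooth3_ex F _ _ u HF)))|].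
change (Derive _ c1) with (D1 F c1 (y s) (z s)) in E1.
change (Derive _ c2) with (D2 F (x t) c2 (z s)) in E2.
change (Derive _ c3) with (D3 F (x t) (y t) c3) in E3.
(* The partial derivatives at the intermediate points are within [e] of those at
   the base point. *)
assert (Z0 : forall u (dd : posreal), Rabs (u - u) < dd).
{ intros u dd; rewrite Rminus_diag, Rabs_R0; apply dd. }
assert (G1 : Rabs (D1 F c1 (y s) (z s) - a1) < e) by (apply C1; lra).
assert (G2 : Rabs (D2 F (x t) c2 (z s) - a2) < e) by (apply C2; try apply Z0; lra).
assert (G3 : Rabs (D3 F (x t) (y t) c3 - a3) < e) by (apply C3; try apply Z0; lra).
set (g1 := D1 F c1 (y s) (z s) - a1) in *.
set (g2 := D2 F (x t) c2 (z s) - a2) in *.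
set (g3 := D3 F (x t) (y t) c3 - a3) in *.
(* The error made along one axis, with [a] the partial derivative at the base point
   and [g + a] that at the intermediate point. *)
assert (P : forall (u : R -> R) du a g dA,
  Rabs (u s - u t - (s - t) * du) <= e * Rabs (s - t) -> Rabs g < e -> dA = (g + a) * (u s - u t) ->
  Rabs (dA - (s - t) * (du * a)) <= e * Rabs (s - t) * (Rabs du + 1 + Rabs a)).
{ intros u du a g dA Iu Gg ->.
  set (q := u s - u t - (s - t) * du) in *.
  replace ((g + a) * (u s - u t) - (s - t) * (du * a))
    with (g * (q + (s - t) * du) + a * q) by (unfold q; ring).
  assert (Q : Rabs (q + (s - t) * du) <= Rabs (s - t) * (1 + Rabs du)).
  { eapply Rle_trans; [apply Rabs_triang|]. rewrite Rabs_mult.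
    generalize (Rabs_pos (s - t)); nra. }
  eapply Rle_trans; [apply Rabs_triang|]. rewrite !Rabs_mult.
  generalize (Rabs_pos (s - t)) (Rabs_pos du) (Rabs_pos a) (Rabs_pos g)
    (Rabs_pos (q + (s - t) * du)) (Rabs_pos q); intros.
  assert (Rabs g * Rabs (q + (s - t) * du) <= e * (Rabs (s - t) * (1 + Rabs du))).
  { apply Rmult_le_compat; lra. }
  assert (Rabs a * Rabs q <= Rabs a * (e * Rabs (s - t))) by (apply Rmult_le_compat_l; lra).
  lra. }
generalize (P x dx a1 g1 _ Ix G1 eq_refl) (P y dy a2 g2 _ Iy G2 eq_refl) (P z dz a3 g3 _ Iz G3 eq_refl).
intros Q1 Q2 Q3; clear P.
set (p1 := (g1 + a1) * (x s - x t)) in *.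
set (p2 := (g2 + a2) * (y s - y t)) in *.
set (p3 := (g3 + a3) * (z s - z t)) in *.
replace (F (x s) (y s) (z s) - F (x t) (y t) (z t) - (s - t) * (dx * a1 + dy * a2 + dz * a3))
  with ((p1 - (s - t) * (dx * a1)) + (p2 - (s - t) * (dy * a2)) + (p3 - (s - t) * (dz * a3))).
2:{ replace p1 with (F (x s) (y s) (z s) - F (x t) (y s) (z s)) by (rewrite E1; unfold p1, g1; ring).
    replace p2 with (F (x t) (y s) (z s) - F (x t) (y t) (z s)) by (rewrite E2; unfold p2, g2; ring).
    replace p3 with (F (x t) (y t) (z s) - F (x t) (y t) (z t)) by (rewrite E3; unfold p3, g3; ring).
    ring. }
eapply Rle_trans; [apply Rabs_triang|].
eapply Rle_trans; [apply Rplus_le_compat; [apply Rabs_triang|apply Rle_refl]|].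
apply Rle_trans with (e * K * Rabs (s - t)).
- unfold K; lra.
- apply Rmult_le_compat_r; [apply Rabs_pos|exact eK].
Qed.

(** * Real functions on the sphere *)

(** The restriction to the sphere of a function on three-space, in the
    coordinates of longitude and height. As [sqrt] vanishes on negative numbers,
    it inherits continuity at all heights, the poles included. *)
Definition pull (F : R -> R -> R -> R) : R -> R -> R :=
  fun lambda mu => F (sqrt (1 - mu ^ 2) * cos lambda) (sqrt (1 - mu ^ 2) * sin lambda) mu.

(** Agreement away from the poles. *)
Definition eq_on_sphere (f g : R -> R -> R) : Prop :=
  forall lambda mu, -1 < mu < 1 -> f lambda mu = g lambda mu.

(** Smooth real functions on the sphere. *)
Definition rsmooth (f : R -> R -> R) : Prop := exists F, smooth3 F /\ eq_on_sphere f (pull F).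

(** The derivative of a real function in the longitude. *)
Definition rd_lambda (f : R -> R -> R) : R -> R -> R := fun x y => Derive (fun t => f t y) x.
(** The derivative of a real function in the height. *)
Definition rd_mu (f : R -> R -> R) : R -> R -> R := fun x y => Derive (fun t => f x t) y.

(** The Poisson bracket of real functions. *)
Definition rpoisson (f g : R -> R -> R) : R -> R -> R :=
  fun x y => rd_lambda f x y * rd_mu g x y - rd_mu f x y * rd_lambda g x y.

(** The factor through which the derivative in the height of a smooth function
    is singular at the poles. *)
Definition pole_factor (mu : R) : R := mu / (1 - mu ^ 2).

Lemma one_minus_sqr_pos mu : -1 < mu < 1 -> 0 < 1 - mu ^ 2.
Proof. intros H; nra. Qed.

Lemma locally_height (P : R -> Prop) mu : -1 < mu < 1 -> (forall t, -1 < t < 1 -> P t) ->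
  locally mu P.
Proof.
intros H HP.
assert (Hd : 0 < Rmin (mu + 1) (1 - mu)) by (apply Rmin_case; lra).
exists (mkposreal _ Hd); intros t Ht.
apply HP.
assert (A := Rmin_l (mu + 1) (1 - mu)); assert (B := Rmin_r (mu + 1) (1 - mu)).
change (Rabs (t - mu) < Rmin (mu + 1) (1 - mu)) in Ht.
apply Rabs_def2 in Ht; lra.
Qed.

Lemma locally_2d_height (P : R -> R -> Prop) lambda mu :
  -1 < mu < 1 -> (forall s t, -1 < t < 1 -> P s t) -> locally_2d P lambda mu.
Proof.
intros H HP.
destruct (locally_height (fun t => -1 < t < 1) mu H (fun t h => h)) as (d & Hd).
exists d; intros s t _ Ht; apply HP, Hd, Ht.
Qed.

Lemma eq_on_sphere_sym f g : eq_on_sphere f g -> eq_on_sphere g f.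
Proof. intros H l m Hm; symmetry; now apply H. Qed.

Lemma rsmooth_ext f g : eq_on_sphere g f -> rsmooth f -> rsmooth g.
Proof.
intros H (F & HF & E); exists F; split; [exact HF|].
intros l m Hm; rewrite (H l m Hm); now apply E.
Qed.

Lemma rd_lambda_ext f g : eq_on_sphere f g -> eq_on_sphere (rd_lambda f) (rd_lambda g).
Proof. intros H l m Hm; apply Derive_ext; intros t; now apply H. Qed.

Lemma rd_mu_ext f g : eq_on_sphere f g -> eq_on_sphere (rd_mu f) (rd_mu g).
Proof.
intros H l m Hm; apply Derive_ext_loc, (locally_height _ m Hm); intros t Ht; now apply H.
Qed.

Lemma rpoisson_ext f f' g g' : eq_on_sphere f f' -> eq_on_sphere g g' ->
  eq_on_sphere (rpoisson f g) (rpoisson f' g').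
Proof.
intros H H' l m Hm; unfold rpoisson.
now rewrite (rd_lambda_ext _ _ H l m Hm), (rd_mu_ext _ _ H l m Hm), (rd_lambda_ext _ _ H' l m Hm),
  (rd_mu_ext _ _ H' l m Hm).
Qed.

Lemma rsmooth_const c : rsmooth (fun _ _ => c).
Proof. exists (fun _ _ _ => c); split; [apply smooth3_const|now intros l m _]. Qed.

Lemma rsmooth_plus f g : rsmooth f -> rsmooth g -> rsmooth (fun l m => f l m + g l m).
Proof.
intros (F & HF & EF) (G & HG & EG); exists (fun x y z => F x y z + G x y z); split.
- now apply smooth3_plus.
- intros l m Hm; now rewrite (EF l m Hm), (EG l m Hm).
Qed.

Lemma rsmooth_mult f g : rsmooth f -> rsmooth g -> rsmooth (fun l m => f l m * g l m).
Proof.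
intros (F & HF & EF) (G & HG & EG); exists (fun x y z => F x y z * G x y z); split.
- now apply smooth3_mult.
- intros l m Hm; now rewrite (EF l m Hm), (EG l m Hm).
Qed.

Lemma rsmooth_scal c f : rsmooth f -> rsmooth (fun l m => c * f l m).
Proof. intros H; exact (rsmooth_mult _ _ (rsmooth_const c) H). Qed.

Lemma rsmooth_minus f g : rsmooth f -> rsmooth g -> rsmooth (fun l m => f l m - g l m).
Proof.
intros Hf Hg; apply (rsmooth_ext (fun l m => f l m + (-1) * g l m)).
- intros l m _; ring.
- apply rsmooth_plus; [|apply rsmooth_scal]; assumption.
Qed.

(** The Cartesian coordinates, as functions on the sphere. *)
Definition coord_x : R -> R -> R := fun l m => sqrt (1 - m ^ 2) * cos l.
Definition coord_y : R -> R -> R := fun l m => sqrt (1 - m ^ 2) * sin l.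
Definition coord_z : R -> R -> R := fun l m => m.

Lemma smooth3_Z : smooth3 (fun _ _ z => z).
Proof.
apply (smooth3_Zfun (fun z => z)).
intros [|[|n]] x; [exact I|exact (@ex_derive_id R_AbsRing x)|].
apply (@ex_derive_ext R_AbsRing R_NormedModule (fun _ => Derive_n (fun _ => 1) n 0)).
2: apply ex_derive_const.
intros t; rewrite <- Derive_n_Derive; rewrite (Derive_n_ext _ (fun _ => 1) _ t (fun u => Derive_id u)).
destruct n; [easy|]; now rewrite !Derive_n_const.
Qed.

Lemma rsmooth_coord_x : rsmooth coord_x.
Proof. exists (fun x _ _ => x); split; [apply smooth3_X|now intros l m _]. Qed.
Lemma rsmooth_coord_y : rsmooth coord_y.
Proof. exists (fun _ y _ => y); split; [apply smooth3_Y|now intros l m _]. Qed.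
Lemma rsmooth_coord_z : rsmooth coord_z.
Proof. exists (fun _ _ z => z); split; [apply smooth3_Z|now intros l m _]. Qed.

Lemma is_derive_sqrt_mu mu : -1 < mu < 1 ->
  is_derive (fun t => sqrt (1 - t ^ 2)) mu (- mu / sqrt (1 - mu ^ 2)).
Proof.
intros H; assert (H2 := one_minus_sqr_pos mu H).
assert (S := sqrt_lt_R0 _ H2).
auto_derive; [lra|].
match goal with |- context [sqrt ?e] => progress replace e with (1 - mu ^ 2) by ring end.
field; lra.
Qed.

(** Rotation about the third axis, as a differential operator on three-space; on
    the sphere it is the derivative in the longitude. *)
Definition Dlam (F : R -> R -> R -> R) := fun x y z => - y * D1 F x y z + x * D2 F x y z.
(** Minus the Euler field of the horizontal plane: along a meridian the
    derivative of a horizontal coordinate is minus the pole factor times the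
    coordinate. *)
Definition Drad (F : R -> R -> R -> R) := fun x y z => - 1 * (x * D1 F x y z + y * D2 F x y z).

Lemma smooth3_Dlam F : smooth3 F -> smooth3 (Dlam F).
Proof.
intros H; destruct (smooth3_D F H) as (H1 & H2 & H3).
replace (Dlam F) with (fun x y z => -1 * (y * D1 F x y z) + x * D2 F x y z).
- repeat first [apply smooth3_plus|apply smooth3_mult]; try assumption;
   first [apply smooth3_const|apply smooth3_X|apply smooth3_Y].
- fext; unfold Dlam; ring.
Qed.

Lemma smooth3_Drad F : smooth3 F -> smooth3 (Drad F).
Proof.
intros H; destruct (smooth3_D F H) as (H1 & H2 & H3).
apply smooth3_mult; [apply smooth3_const|].
apply smooth3_plus; apply smooth3_mult; try assumption;
   first [apply smooth3_X|apply smooth3_Y].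
Qed.

Lemma is_derive_pull_lambda F lambda mu : smooth3 F ->
  is_derive (fun t => pull F t mu) lambda (pull (Dlam F) lambda mu).
Proof.
intros HF; unfold pull, Dlam.
set (r := sqrt (1 - mu ^ 2)).
replace (- (r * sin lambda) * D1 F (r * cos lambda) (r * sin lambda) mu +
   r * cos lambda * D2 F (r * cos lambda) (r * sin lambda) mu)
 with ((- (r * sin lambda)) * D1 F (r * cos lambda) (r * sin lambda) mu +
   r * cos lambda * D2 F (r * cos lambda) (r * sin lambda) mu +
   0 * D3 F (r * cos lambda) (r * sin lambda) mu) by ring.
apply (is_derive_comp3 F (fun t => r * cos t) (fun t => r * sin t) (fun _ => mu)).
- exact HF.
- auto_derive; [easy|ring].
- auto_derive; [easy|ring].
- apply (@is_derive_const R_AbsRing R_NormedModule).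
Qed.

Lemma is_derive_pull_mu F lambda mu : smooth3 F -> -1 < mu < 1 ->
  is_derive (fun t => pull F lambda t) mu
    (pull (D3 F) lambda mu + pole_factor mu * pull (Drad F) lambda mu).
Proof.
intros HF Hm; assert (H2 := one_minus_sqr_pos mu Hm).
assert (S := sqrt_lt_R0 _ H2). assert (S2 := sqrt_sqrt _ (Rlt_le _ _ H2)).
assert (Dr := is_derive_sqrt_mu mu Hm).
unfold pull, Drad, pole_factor.
set (r := sqrt (1 - mu ^ 2)) in *.
set (A := D1 F _ _ _); set (B := D2 F _ _ _); set (C := D3 F _ _ _).
replace (C + mu / (1 - mu ^ 2) * (- 1 * (r * cos lambda * A + r * sin lambda * B)))
 with ((- mu / r * cos lambda) * A + (- mu / r * sin lambda) * B + 1 * C).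
- apply (is_derive_comp3 F (fun t => sqrt (1 - t ^ 2) * cos lambda)
    (fun t => sqrt (1 - t ^ 2) * sin lambda) (fun t => t)).
  + exact HF.
  + apply (is_derive_scal_l (fun t => sqrt (1 - t ^ 2)) mu _ (cos lambda) Dr).
  + apply (is_derive_scal_l (fun t => sqrt (1 - t ^ 2)) mu _ (sin lambda) Dr).
  + apply (@is_derive_id R_AbsRing).
- rewrite <- S2; field; lra.
Qed.

Lemma rd_lambda_pull F l m : smooth3 F -> rd_lambda (pull F) l m = pull (Dlam F) l m.
Proof. intros HF; exact (is_derive_unique _ _ _ (is_derive_pull_lambda F l m HF)). Qed.

Lemma rd_mu_pull F l m : smooth3 F -> -1 < m < 1 ->
  rd_mu (pull F) l m = pull (D3 F) l m + pole_factor m * pull (Drad F) l m.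
Proof. intros HF Hm; exact (is_derive_unique _ _ _ (is_derive_pull_mu F l m HF Hm)). Qed.

Lemma rsmooth_rd_lambda f : rsmooth f -> rsmooth (rd_lambda f) /\
  forall l m, -1 < m < 1 -> is_derive (fun t => f t m) l (rd_lambda f l m).
Proof.
intros (F & HF & E).
assert (D : forall l m, -1 < m < 1 -> is_derive (fun t => f t m) l (pull (Dlam F) l m)).
{ intros l m Hm. apply (is_derive_ext (fun t => pull F t m)).
  - intros t; symmetry; now apply E.
  - now apply is_derive_pull_lambda. }
split.
- exists (Dlam F); split; [now apply smooth3_Dlam|].
  intros l m Hm; now apply is_derive_unique, D.
- intros l m Hm; apply Derive_correct; eexists; now apply D.
Qed.

(** The derivative in the height is singular at the poles, but only through the
    pole factor. *)
Lemma rsmooth_rd_mu f : rsmooth f -> exists h1 h2, rsmooth h1 /\ rsmooth h2 /\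
  forall l m, -1 < m < 1 -> is_derive (fun t => f l t) m (h1 l m + pole_factor m * h2 l m).
Proof.
intros (F & HF & E).
exists (pull (D3 F)), (pull (Drad F)); split; [|split].
- exists (D3 F); split; [apply (smooth3_D F HF)|now intros l m _].
- exists (Drad F); split; [now apply smooth3_Drad|now intros l m _].
- intros l m Hm. apply (is_derive_ext_loc (fun t => pull F l t)).
  + apply (locally_height _ m Hm); intros t Ht; symmetry; now apply E.
  + now apply is_derive_pull_mu.
Qed.

Lemma is_derive_rd_lambda f l m : rsmooth f -> -1 < m < 1 ->
  is_derive (fun t => f t m) l (rd_lambda f l m).
Proof. intros Hf; apply (rsmooth_rd_lambda f Hf). Qed.

Lemma is_derive_rd_mu f l m : rsmooth f -> -1 < m < 1 ->
  is_derive (fun t => f l t) m (rd_mu f l m).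
Proof.
intros Hf Hm; destruct (rsmooth_rd_mu f Hf) as (h1 & h2 & _ & _ & D).
apply Derive_correct; eexists; now apply D.
Qed.

(** On the sphere the bracket is the triple product of the position vector and
    the two gradients, in which the singularities cancel. *)
Lemma rsmooth_rpoisson f g : rsmooth f -> rsmooth g -> rsmooth (rpoisson f g).
Proof.
intros (F & HF & EF) (G & HG & EG).
destruct (smooth3_D F HF) as (F1 & F2 & F3), (smooth3_D G HG) as (G1 & G2 & G3).
exists (fun x y z => x * (D2 F x y z * D3 G x y z + -1 * (D3 F x y z * D2 G x y z))
  + y * (D3 F x y z * D1 G x y z + -1 * (D1 F x y z * D3 G x y z))
  + z * (D1 F x y z * D2 G x y z + -1 * (D2 F x y z * D1 G x y z))).
split.
- repeat first [apply smooth3_plus|apply smooth3_mult]; try assumption;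
   first [apply smooth3_const|apply smooth3_X|apply smooth3_Y|apply smooth3_Z].
- intros l m Hm.
  rewrite (rpoisson_ext f (pull F) g (pull G) EF EG l m Hm).
  unfold rpoisson.
  rewrite (rd_lambda_pull F l m HF), (rd_lambda_pull G l m HG), (rd_mu_pull F l m HF Hm), (rd_mu_pull G l m HG Hm).
  assert (H2 := one_minus_sqr_pos m Hm). assert (S2 := sqrt_sqrt _ (Rlt_le _ _ H2)).
  unfold pull, Dlam, Drad, pole_factor.
  set (r := sqrt (1 - m ^ 2)) in *.
  set (A := D1 F _ _ _); set (B := D2 F _ _ _); set (C := D3 F _ _ _).
  set (A' := D1 G _ _ _); set (B' := D2 G _ _ _); set (C' := D3 G _ _ _).
  rewrite <- S2.
  assert (R0 : r <> 0) by (intros E0; rewrite E0 in S2; lra).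
  assert (SC : cos l ^ 2 = 1 - sin l ^ 2) by (generalize (sin2_cos2 l); unfold Rsqr; lra).
  field_simplify_eq; [|assumption]. ring_simplify. rewrite SC. ring.
Qed.

(** The bracket is a derivation. *)
Lemma rpoisson_mult f g h : rsmooth f -> rsmooth g -> rsmooth h ->
  eq_on_sphere (rpoisson f (fun l m => g l m * h l m))
      (fun l m => rpoisson f g l m * h l m + g l m * rpoisson f h l m).
Proof.
intros Hf Hg Hh l m Hm; unfold rpoisson.
assert (E1 : rd_lambda (fun l m => g l m * h l m) l m = rd_lambda g l m * h l m + g l m * rd_lambda h l m).
{ apply (Derive_mult (fun t => g t m) (fun t => h t m) l);
    eexists; now apply is_derive_rd_lambda. }
assert (E2 : rd_mu (fun l m => g l m * h l m) l m = rd_mu g l m * h l m + g l m * rd_mu h l m).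
{ apply (Derive_mult (fun t => g l t) (fun t => h l t) m);
    eexists; now apply is_derive_rd_mu. }
rewrite E1, E2; ring.
Qed.

Lemma rpoisson_anti f g l m : rpoisson f g l m = - rpoisson g f l m.
Proof. unfold rpoisson; ring. Qed.

(** * Continuity and mixed derivatives *)

(* Restates as an equality of reals one whose type is a normed module on them. *)
Ltac toR := match goal with |- @eq _ ?a ?b => change (@eq R a b) end.

Lemma continuity_2d_swap (f : R -> R -> R) x y :
  continuity_2d_pt f x y -> continuity_2d_pt (fun u v => f v u) y x.
Proof.
intros H eps; destruct (H eps) as (d & Hd); exists d; intros u v Hu Hv; now apply Hd.
Qed.

Lemma continuous_sqrt_mu mu : continuity_pt (fun t => sqrt (1 - t ^ 2)) mu.
Proof.
apply continuity_pt_filterlim.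
apply (continuous_comp (fun t => 1 - t ^ 2) sqrt).
- apply (@ex_derive_continuous R_AbsRing R_NormedModule); auto_derive; easy.
- apply continuous_sqrt.
Qed.

Lemma continuity_2d_pull F l m : Ck3 0 F -> continuity_2d_pt (pull F) l m.
Proof.
intros HF eps.
destruct (Ck3_0_eps F (coord_x l m) (coord_y l m) m eps HF) as (d & Hd).
assert (R0 : continuity_2d_pt (fun u v => sqrt (1 - v ^ 2)) l m).
{ apply (continuity_1d_2d_pt_comp (fun t => sqrt (1 - t ^ 2)) (fun u v => v)).
  apply continuous_sqrt_mu. apply continuity_2d_pt_id2. }
assert (X0 : continuity_2d_pt coord_x l m).
{ apply continuity_2d_pt_mult; [exact R0|].
  apply (continuity_1d_2d_pt_comp cos (fun u v => u)).
  apply continuity_cos. apply continuity_2d_pt_id1. }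
assert (Y0 : continuity_2d_pt coord_y l m).
{ apply continuity_2d_pt_mult; [exact R0|].
  apply (continuity_1d_2d_pt_comp sin (fun u v => u)).
  apply continuity_sin. apply continuity_2d_pt_id1. }
generalize (X0 d) (Y0 d) (continuity_2d_pt_id2 l m d); intros A B C.
generalize (locally_2d_and _ _ _ _ A (locally_2d_and _ _ _ _ B C)).
apply locally_2d_impl, locally_2d_forall; intros u v (A' & B' & C').
now apply Hd.
Qed.

Lemma rsmooth_continuous f l m : rsmooth f -> -1 < m < 1 -> continuity_2d_pt f l m.
Proof.
intros (F & HF & E) Hm.
apply (continuity_2d_pt_ext_loc (pull F)).
- apply locally_2d_height; [exact Hm|]; intros s t Ht; symmetry; now apply E.
- apply continuity_2d_pull, HF.
Qed.

Lemma pole_factor_continuous l m : -1 < m < 1 -> continuity_2d_pt (fun _ v => pole_factor v) l m.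
Proof.
intros Hm; assert (H2 := one_minus_sqr_pos m Hm).
apply (continuity_1d_2d_pt_comp pole_factor (fun u v => v)); [|apply continuity_2d_pt_id2].
apply continuity_pt_filterlim, (@ex_derive_continuous R_AbsRing R_NormedModule).
unfold pole_factor; auto_derive. lra.
Qed.

Lemma rd_mu_continuous f l m : rsmooth f -> -1 < m < 1 -> continuity_2d_pt (rd_mu f) l m.
Proof.
intros Hf Hm; destruct (rsmooth_rd_mu f Hf) as (h1 & h2 & H1 & H2 & D).
apply (continuity_2d_pt_ext_loc (fun u v => h1 u v + pole_factor v * h2 u v)).
- apply locally_2d_height; [exact Hm|]; intros s t Ht; symmetry; now apply is_derive_unique, D.
- apply continuity_2d_pt_plus; [|apply continuity_2d_pt_mult];
   [now apply rsmooth_continuous|now apply pole_factor_continuous|now apply rsmooth_continuous].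
Qed.

(** The derivative in the height can be differentiated along the parallels. *)
Lemma rsmooth_rd_lambda_rd_mu f : rsmooth f -> exists k1 k2, rsmooth k1 /\ rsmooth k2 /\
  forall l m, -1 < m < 1 -> is_derive (fun t => rd_mu f t m) l (k1 l m + pole_factor m * k2 l m).
Proof.
intros Hf; destruct (rsmooth_rd_mu f Hf) as (h1 & h2 & H1 & H2 & D).
exists (rd_lambda h1), (rd_lambda h2); split; [apply (rsmooth_rd_lambda h1 H1)|split; [apply (rsmooth_rd_lambda h2 H2)|]].
intros l m Hm.
apply (is_derive_ext (fun t => h1 t m + pole_factor m * h2 t m)).
- intros t; symmetry; now apply is_derive_unique, D.
- apply (@is_derive_plus R_AbsRing R_NormedModule (fun t => h1 t m) (fun t => pole_factor m * h2 t m)).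
  + now apply is_derive_rd_lambda.
  + apply (is_derive_scal (fun t => h2 t m) l (pole_factor m)). now apply is_derive_rd_lambda.
Qed.

(** Symmetry of the mixed derivatives. *)
Lemma rsmooth_Schwarz f l m : rsmooth f -> -1 < m < 1 ->
  rd_lambda (rd_mu f) l m = rd_mu (rd_lambda f) l m.
Proof.
intros Hf Hm.
destruct (rsmooth_rd_lambda_rd_mu f Hf) as (k1 & k2 & K1 & K2 & D).
destruct (rsmooth_rd_lambda f Hf) as (Hl & Dl).
apply (Schwarz f l m).
- apply locally_2d_height; [exact Hm|]; intros s t Ht; repeat split; eexists.
  + now apply Dl.
  + now apply is_derive_rd_mu.
  + exact (D s t Ht).
  + exact (is_derive_rd_mu (rd_lambda f) s t Hl Ht).
- apply (continuity_2d_pt_ext_loc (fun u v => k1 u v + pole_factor v * k2 u v)).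
  + apply locally_2d_height; [exact Hm|]; intros s t Ht; symmetry.
    exact (is_derive_unique _ _ _ (D s t Ht)).
  + apply continuity_2d_pt_plus; [|apply continuity_2d_pt_mult];
     [now apply rsmooth_continuous|now apply pole_factor_continuous|now apply rsmooth_continuous].
- exact (rd_mu_continuous (rd_lambda f) l m Hl Hm).
Qed.

(** * Integration over the sphere *)

(** The integral over the parallel of a given height. *)
Definition parallel_int (f : R -> R -> R) (m : R) : R := RInt (fun l => f l m) 0 (2 * PI).
(** The integral over the sphere, whose area form is the product of the two
    coordinate forms. *)
Definition sphere_int (f : R -> R -> R) : R := RInt (parallel_int f) (-1) 1.

Lemma TwoPI_pos : 0 < 2 * PI.
Proof. generalize PI_RGT_0; lra. Qed.

Lemma continuity_2d_fst (g : R -> R -> R) l m : continuity_2d_pt g l m ->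
  continuous (fun t => g t m) l.
Proof.
intros H; apply filterlim_locally; intros eps; destruct (H eps) as (d & Hd).
exists d; intros t Ht; apply Hd; [exact Ht|].
rewrite Rminus_diag, Rabs_R0; apply d.
Qed.

Lemma ex_RInt_parallel (g : R -> R -> R) m : (forall l, continuity_2d_pt g l m) ->
  ex_RInt (fun l => g l m) 0 (2 * PI).
Proof.
intros H; apply (@ex_RInt_continuous R_CompleteNormedModule); intros l _.
now apply continuity_2d_fst.
Qed.

Lemma continuous_parallel_int (g : R -> R -> R) m : (forall l m', continuity_2d_pt g l m') ->
  continuous (parallel_int g) m.
Proof.
intros H; apply filterlim_locally; intros eps.
assert (P := TwoPI_pos).
assert (He : 0 < eps / (2 * (2 * PI))) by (apply Rdiv_lt_0_compat; [apply eps|lra]).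
destruct (uniform_continuity_2d_1d g 0 (2 * PI) m (fun l _ => H l m) (mkposreal _ He))
  as (d & Hd).
exists d; intros t Ht.
change (Rabs (t - m) < d) in Ht. apply Rabs_def2 in Ht.
change (Rabs (parallel_int g t - parallel_int g m) < eps). unfold parallel_int.
rewrite <- (RInt_minus (V := R_CompleteNormedModule) (fun l => g l t) (fun l => g l m))
  by (apply ex_RInt_parallel; intros; apply H).
eapply Rle_lt_trans.
- apply (abs_RInt_le_const _ 0 (2 * PI) (eps / (2 * (2 * PI)))); [lra| |].
  + apply (@ex_RInt_minus R_NormedModule); apply ex_RInt_parallel; intros; apply H.
  + intros l Hl. apply Rlt_le. apply (Hd l m l t); try lra.
    rewrite Rminus_diag, Rabs_R0; apply d.
- generalize (cond_pos eps); intros. replace ((2 * PI - 0) * (eps / (2 * (2 * PI)))) with (eps / 2)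
   by (field; lra). lra.
Qed.

Lemma parallel_int_ext f g m : eq_on_sphere f g -> -1 < m < 1 ->
  parallel_int f m = parallel_int g m.
Proof. intros H Hm; apply RInt_ext; intros; now apply H. Qed.

Lemma sphere_int_ext f g : eq_on_sphere f g -> sphere_int f = sphere_int g.
Proof.
intros H; apply RInt_ext; intros m Hm; rewrite Rmin_left, Rmax_right in Hm by lra.
now apply parallel_int_ext.
Qed.

Lemma rsmooth_ex_RInt_parallel f m : rsmooth f -> -1 < m < 1 ->
  ex_RInt (fun l => f l m) 0 (2 * PI).
Proof. intros Hf Hm; apply ex_RInt_parallel; intros l; now apply rsmooth_continuous. Qed.

Lemma rsmooth_ex_RInt_height f : rsmooth f -> ex_RInt (parallel_int f) (-1) 1.
Proof.
intros (F & HF & E).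
apply (ex_RInt_ext (parallel_int (pull F))).
- intros m Hm; rewrite Rmin_left, Rmax_right in Hm by lra.
  apply parallel_int_ext; [now apply eq_on_sphere_sym|exact Hm].
- apply (@ex_RInt_continuous R_CompleteNormedModule); intros m _.
  apply continuous_parallel_int; intros; apply continuity_2d_pull, HF.
Qed.

Lemma sphere_int_plus f g : rsmooth f -> rsmooth g ->
  sphere_int (fun l m => f l m + g l m) = sphere_int f + sphere_int g.
Proof.
intros Hf Hg; unfold sphere_int.
rewrite <- (RInt_plus (V := R_CompleteNormedModule) (parallel_int f) (parallel_int g))
  by now apply rsmooth_ex_RInt_height.
apply RInt_ext; intros m Hm; rewrite Rmin_left, Rmax_right in Hm by lra.
apply (RInt_plus (V := R_CompleteNormedModule) (fun l => f l m) (fun l => g l m));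
  now apply rsmooth_ex_RInt_parallel.
Qed.

Lemma sphere_int_scal c f : rsmooth f -> sphere_int (fun l m => c * f l m) = c * sphere_int f.
Proof.
intros Hf; unfold sphere_int.
rewrite <- (RInt_scal (V := R_CompleteNormedModule) (parallel_int f)) by now apply rsmooth_ex_RInt_height.
apply RInt_ext; intros m Hm; rewrite Rmin_left, Rmax_right in Hm by lra.
apply (RInt_scal (V := R_CompleteNormedModule) (fun l => f l m));
  now apply rsmooth_ex_RInt_parallel.
Qed.

Lemma sphere_int_minus f g : rsmooth f -> rsmooth g ->
  sphere_int (fun l m => f l m - g l m) = sphere_int f - sphere_int g.
Proof.
intros Hf Hg.
rewrite (sphere_int_ext _ (fun l m => f l m + (-1) * g l m)) by (intros l m _; ring).
rewrite sphere_int_plus, sphere_int_scal by (try assumption; now apply rsmooth_scal). ring.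
Qed.

(** The fundamental theorem of calculus when the primitive is differentiable in
    the open interval only. *)
Lemma RInt_open_derive (P q : R -> R) a b : a <= b ->
  (forall t, continuous P t) -> (forall t, continuous q t) ->
  (forall t, a < t < b -> is_derive P t (q t)) -> RInt q a b = P b - P a.
Proof.
intros ab CP Cq D.
assert (Dq : forall t, is_derive (fun t => RInt q a t) t (q t)).
{ intros t. apply (is_derive_RInt q (fun t => RInt q a t) a t); [|apply Cq].
  exists (mkposreal 1 Rlt_0_1); intros s _.
  apply (@RInt_correct R_CompleteNormedModule).
  apply (@ex_RInt_continuous R_CompleteNormedModule); intros; apply Cq. }
destruct (MVT_gen (fun t => RInt q a t - P t) a b (fun _ => 0)) as (c & _ & E).
- intros t Ht; rewrite Rmin_left, Rmax_right in Ht by lra.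
  replace 0 with (q t - q t) by ring.
  apply (@is_derive_minus R_AbsRing R_NormedModule (fun t => RInt q a t) P); [apply Dq|now apply D].
- intros t _; apply continuity_pt_filterlim.
  apply (@continuous_minus R_UniformSpace R_AbsRing R_NormedModule (fun t => RInt q a t) P); [|apply CP].
  apply (@ex_derive_continuous R_AbsRing R_NormedModule); eexists; apply Dq.
- rewrite RInt_point in E. unfold zero in E; simpl in E. lra.
Qed.

Lemma rd_mu_periodic f m : eq_on_sphere f (fun l m => f (l + 2 * PI) m) -> -1 < m < 1 ->
  rd_mu f (2 * PI) m = rd_mu f 0 m.
Proof.
intros H Hm. symmetry.
apply Derive_ext_loc, (locally_height _ m Hm); intros t Ht.
rewrite (H 0 t Ht). now rewrite Rplus_0_l.
Qed.

Lemma rsmooth_periodic f : rsmooth f -> eq_on_sphere f (fun l m => f (l + 2 * PI) m).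
Proof.
intros (F & _ & E) l m Hm; rewrite !E by assumption; unfold pull.
now rewrite cos_plus, sin_plus, cos_2PI, sin_2PI, !Rmult_1_r, !Rmult_0_r, Rminus_0_r, Rplus_0_r.
Qed.

(** The bracket is the difference of two derivatives, {f,g} = (f g_mu)_lambda -
    (f g_lambda)_mu; the first one has integral zero over every parallel. *)
Lemma parallel_int_rpoisson f g m : rsmooth f -> rsmooth g -> -1 < m < 1 ->
  parallel_int (rpoisson f g) m = - parallel_int (rd_mu (fun l m => f l m * rd_lambda g l m)) m.
Proof.
intros Hf Hg Hm.
destruct (rsmooth_rd_lambda g Hg) as (Hl & _).
set (p := fun l m => f l m * rd_lambda g l m).
assert (Hp : rsmooth p) by now apply rsmooth_mult.
destruct (rsmooth_rd_lambda_rd_mu g Hg) as (k1 & k2 & K1 & K2 & Dk).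
assert (Cp : ex_RInt (fun l => rd_mu p l m) 0 (2 * PI)).
{ apply ex_RInt_parallel; intros l; now apply rd_mu_continuous. }
assert (E : forall l, rpoisson f g l m + rd_mu p l m = rd_lambda f l m * rd_mu g l m + f l m * rd_lambda (rd_mu g) l m).
{ intros l. rewrite rsmooth_Schwarz by assumption.
  assert (Ep : rd_mu p l m = rd_mu f l m * rd_lambda g l m + f l m * rd_mu (rd_lambda g) l m).
  { apply (Derive_mult (fun t => f l t) (fun t => rd_lambda g l t) m);
     eexists; now apply is_derive_rd_mu. }
  rewrite Ep; unfold rpoisson; ring. }
assert (I0 : RInt (fun l => rpoisson f g l m + rd_mu p l m) 0 (2 * PI) = 0).
{ rewrite (RInt_ext _ (fun l => rd_lambda f l m * rd_mu g l m + f l m * rd_lambda (rd_mu g) l m)) by (intros; apply E).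
  transitivity (f (2 * PI) m * rd_mu g (2 * PI) m - f 0 m * rd_mu g 0 m).
  - apply is_RInt_unique.
    apply (is_RInt_derive (V := R_CompleteNormedModule) (fun l => f l m * rd_mu g l m)).
    + intros l _.
      apply (is_derive_mult (fun l => f l m) (fun l => rd_mu g l m)).
      * now apply is_derive_rd_lambda.
      * apply Derive_correct. eexists. now apply Dk.
      * intros; apply Rmult_comm.
    + intros l _.
      apply (continuity_2d_fst (fun l m => rd_lambda f l m * rd_mu g l m + f l m * rd_lambda (rd_mu g) l m)).
      apply continuity_2d_pt_plus; apply continuity_2d_pt_mult.
      * apply rsmooth_continuous; [apply (rsmooth_rd_lambda f Hf)|exact Hm].
      * now apply rd_mu_continuous.
      * now apply rsmooth_continuous.
      * apply (continuity_2d_pt_ext_loc (rd_mu (rd_lambda g))).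
        -- apply locally_2d_height; [exact Hm|]; intros; symmetry; now apply rsmooth_Schwarz.
        -- now apply rd_mu_continuous.
  - rewrite rd_mu_periodic by (try apply rsmooth_periodic; assumption).
    rewrite (rsmooth_periodic f Hf 0 m Hm), Rplus_0_l; apply Rminus_diag. }
assert (I1 : parallel_int (rpoisson f g) m + parallel_int (rd_mu p) m = 0).
{ rewrite <- I0; symmetry.
  exact (RInt_plus (V := R_CompleteNormedModule) (fun l => rpoisson f g l m) (fun l => rd_mu p l m)
    0 (2 * PI) (rsmooth_ex_RInt_parallel _ m (rsmooth_rpoisson f g Hf Hg) Hm) Cp). }
fold p; lra.
Qed.

(** A Poisson bracket has integral zero: by the formula on parallels its
    integral is a difference of boundary terms at the poles, where f g_lambda
    vanishes. *)
Lemma sphere_int_rpoisson f g : rsmooth f -> rsmooth g -> sphere_int (rpoisson f g) = 0.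
Proof.
intros Hf Hg.
destruct (rsmooth_rd_lambda g Hg) as (Hl & _).
set (p := fun l m => f l m * rd_lambda g l m).
assert (Hp : rsmooth p) by now apply rsmooth_mult.
destruct (rsmooth_rpoisson f g Hf Hg) as (H & HH & EH).
destruct Hf as (F & HF & EF); destruct Hg as (G & HG & EG).
set (P := fun x y z => F x y z * Dlam G x y z).
assert (HP : smooth3 P) by (apply smooth3_mult; [|apply smooth3_Dlam]; assumption).
assert (EP : eq_on_sphere p (pull P)).
{ intros l m Hm; unfold p. rewrite (rd_lambda_ext g (pull G) EG l m Hm), rd_lambda_pull by assumption.
  now rewrite (EF l m Hm). }
rewrite (sphere_int_ext _ _ EH); unfold sphere_int.
rewrite (RInt_open_derive (fun m => - parallel_int (pull P) m)).
(* At the poles the extension of f g_lambda is evaluated on the axis, where the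
   rotation field vanishes. *)
- assert (Z : forall m, m ^ 2 = 1 -> parallel_int (pull P) m = 0).
  { intros m Hm; unfold parallel_int.
    rewrite (RInt_ext _ (fun _ => 0)), RInt_const; [apply Rmult_0_r|].
    intros l _; unfold pull; rewrite Hm, Rminus_diag, sqrt_0.
    unfold P, Dlam; toR; ring. }
  rewrite !Z by ring; ring.
- lra.
- intros t; apply (@continuous_opp R_UniformSpace R_AbsRing R_NormedModule).
  apply continuous_parallel_int; intros; apply continuity_2d_pull, HP.
- intros t; apply continuous_parallel_int; intros; apply continuity_2d_pull, HH.
- intros m Hm.
  rewrite <- (parallel_int_ext _ _ m EH Hm).
  rewrite parallel_int_rpoisson by first [assumption|now exists F|now exists G].
  apply (@is_derive_opp R_AbsRing R_NormedModule).
  apply (is_derive_ext_loc (parallel_int p)).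
  { apply (locally_height _ m Hm); intros; now apply parallel_int_ext. }
  apply (is_derive_RInt_param (fun m l => p l m)).
  + apply (locally_height _ m Hm); intros t Ht l _; eexists; now apply is_derive_rd_mu.
  + intros l _; apply continuity_2d_swap. now apply (rd_mu_continuous p).
  + apply (locally_height _ m Hm); intros t Ht; now apply rsmooth_ex_RInt_parallel.
Qed.

(** Invariance of the pairing of real functions under brackets, from the
    derivation property. *)
Lemma sphere_int_rpoisson_adjoint h f g : rsmooth h -> rsmooth f -> rsmooth g ->
  sphere_int (fun l m => h l m * rpoisson f g l m) = sphere_int (fun l m => rpoisson h f l m * g l m).
Proof.
intros Hh Hf Hg.
assert (E := sphere_int_rpoisson f (fun l m => h l m * g l m) Hf (rsmooth_mult _ _ Hh Hg)).
rewrite (sphere_int_ext _ _ (rpoisson_mult f h g Hf Hh Hg)) in E.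
rewrite sphere_int_plus in E by (apply rsmooth_mult; try apply rsmooth_rpoisson; assumption).
rewrite (sphere_int_ext (fun l m => rpoisson h f l m * g l m)
  (fun l m => -1 * (rpoisson f h l m * g l m)))
  by (intros l m _; rewrite (rpoisson_anti h f); ring).
rewrite sphere_int_scal by (apply rsmooth_mult; try apply rsmooth_rpoisson; assumption).
lra.
Qed.

(** * The Laplacian through Poisson brackets *)

(** The Laplacian of real functions. *)
Definition rLaplace (f : R -> R -> R) : R -> R -> R := fun l m =>
  rd_mu (fun l m => (1 - m ^ 2) * rd_mu f l m) l m + / (1 - m ^ 2) * rd_lambda (rd_lambda f) l m.

Lemma rd_lambda_coord_x l m : rd_lambda coord_x l m = - (sqrt (1 - m ^ 2) * sin l).
Proof. unfold rd_lambda, coord_x; generalize (sqrt (1 - m ^ 2)); intros r; apply is_derive_unique; auto_derive; [easy|ring]. Qed.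

Lemma rd_lambda_coord_y l m : rd_lambda coord_y l m = sqrt (1 - m ^ 2) * cos l.
Proof. unfold rd_lambda, coord_y; generalize (sqrt (1 - m ^ 2)); intros r; apply is_derive_unique; auto_derive; [easy|ring]. Qed.

Lemma rd_mu_coord_x l m : -1 < m < 1 -> rd_mu coord_x l m = - (m / sqrt (1 - m ^ 2) * cos l).
Proof.
intros Hm; unfold rd_mu, coord_x; apply is_derive_unique.
replace (- (m / sqrt (1 - m ^ 2) * cos l)) with (- m / sqrt (1 - m ^ 2) * cos l)
  by (unfold Rdiv; ring).
apply (is_derive_scal_l (fun t => sqrt (1 - t ^ 2)) m _ (cos l) (is_derive_sqrt_mu m Hm)).
Qed.

Lemma rd_mu_coord_y l m : -1 < m < 1 -> rd_mu coord_y l m = - (m / sqrt (1 - m ^ 2) * sin l).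
Proof.
intros Hm; unfold rd_mu, coord_y; apply is_derive_unique.
replace (- (m / sqrt (1 - m ^ 2) * sin l)) with (- m / sqrt (1 - m ^ 2) * sin l)
  by (unfold Rdiv; ring).
apply (is_derive_scal_l (fun t => sqrt (1 - t ^ 2)) m _ (sin l) (is_derive_sqrt_mu m Hm)).
Qed.

Lemma rd_lambda_coord_z l m : rd_lambda coord_z l m = 0.
Proof. exact (Derive_const m l). Qed.
Lemma rd_mu_coord_z l m : rd_mu coord_z l m = 1.
Proof. exact (Derive_id m). Qed.

Lemma rpoisson_coord_x f : eq_on_sphere (rpoisson coord_x f) (fun l m =>
  - (sqrt (1 - m ^ 2) * sin l) * rd_mu f l m + m / sqrt (1 - m ^ 2) * cos l * rd_lambda f l m).
Proof. intros l m Hm; unfold rpoisson; rewrite rd_lambda_coord_x, rd_mu_coord_x by assumption; ring. Qed.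

Lemma rpoisson_coord_y f : eq_on_sphere (rpoisson coord_y f) (fun l m =>
  - (sqrt (1 - m ^ 2) * (- cos l)) * rd_mu f l m + m / sqrt (1 - m ^ 2) * sin l * rd_lambda f l m).
Proof. intros l m Hm; unfold rpoisson; rewrite rd_lambda_coord_y, rd_mu_coord_y by assumption; ring. Qed.

Lemma rpoisson_coord_z f l m : rpoisson coord_z f l m = - rd_lambda f l m.
Proof. unfold rpoisson; rewrite rd_lambda_coord_z, rd_mu_coord_z; ring. Qed.

(** The derivatives of the combinations by which the bracket with a horizontal
    coordinate is expressed in the coordinates of longitude and height. *)
Lemma Derive_mu_combination (u v : R -> R) s c m : -1 < m < 1 -> ex_derive u m -> ex_derive v m ->
  Derive (fun t => - (sqrt (1 - t ^ 2) * s) * u t + t / sqrt (1 - t ^ 2) * c * v t) m =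
  s * (m / sqrt (1 - m ^ 2) * u m - sqrt (1 - m ^ 2) * Derive u m)
  + c * (/ (sqrt (1 - m ^ 2) * (1 - m ^ 2)) * v m + m / sqrt (1 - m ^ 2) * Derive v m).
Proof.
intros Hm Hu Hv; assert (H2 := one_minus_sqr_pos m Hm).
assert (S := sqrt_lt_R0 _ H2). assert (S2 := sqrt_sqrt _ (Rlt_le _ _ H2)).
assert (Dr := is_derive_sqrt_mu m Hm).
set (r := fun t => sqrt (1 - t ^ 2)) in *.
change (sqrt (1 - m ^ 2)) with (r m) in *.
assert (Er : ex_derive r m) by (eexists; exact Dr).
assert (R0 : r m <> 0) by lra.
apply is_derive_unique.
change (fun t => - (sqrt (1 - t ^ 2) * s) * u t + t / sqrt (1 - t ^ 2) * c * v t) with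
  (fun t => - (r t * s) * u t + t / r t * c * v t).
assert (Q : Derive r m = - m / r m) by exact (is_derive_unique _ _ _ Dr).
clearbody r.
auto_derive; [repeat split; assumption|].
change (Derive (fun x => u x) m) with (Derive u m).
change (Derive (fun x => v x) m) with (Derive v m).
change (Derive (fun x => r x) m) with (Derive r m).
rewrite Q, <- S2.
field_simplify_eq; [|lra].
replace (m ^ 2) with (1 - r m * r m) by lra. ring_simplify.
replace (m ^ 2) with (1 - r m * r m) by lra. ring.
Qed.

Lemma Derive_lambda_combination_x (u v : R -> R) r k l : ex_derive u l -> ex_derive v l ->
  Derive (fun t => - (r * sin t) * u t + k * cos t * v t) l =
  - r * (cos l * u l + sin l * Derive u l) + k * (cos l * Derive v l - sin l * v l).
Proof.
intros Hu Hv; apply is_derive_unique; auto_derive; [now repeat split|].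
change (Derive (fun x => u x) l) with (Derive u l).
change (Derive (fun x => v x) l) with (Derive v l). ring.
Qed.

Lemma Derive_lambda_combination_y (u v : R -> R) r k l : ex_derive u l -> ex_derive v l ->
  Derive (fun t => - (r * (- cos t)) * u t + k * sin t * v t) l =
  r * (cos l * Derive u l - sin l * u l) + k * (cos l * v l + sin l * Derive v l).
Proof.
intros Hu Hv; apply is_derive_unique; auto_derive; [now repeat split|].
change (Derive (fun x => u x) l) with (Derive u l).
change (Derive (fun x => v x) l) with (Derive v l). ring.
Qed.

Lemma ex_derive_rd_mu f l m : rsmooth f -> -1 < m < 1 -> ex_derive (fun t => rd_mu f l t) m.
Proof.
intros Hf Hm; destruct (rsmooth_rd_mu f Hf) as (h1 & h2 & H1 & H2 & D).
apply (ex_derive_ext_loc (fun t => h1 l t + pole_factor t * h2 l t)).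
- apply (locally_height _ m Hm); intros t Ht; symmetry; now apply is_derive_unique, D.
- apply (@ex_derive_plus R_AbsRing R_NormedModule).
  + eexists; now apply is_derive_rd_mu.
  + apply ex_derive_mult; [|eexists; now apply is_derive_rd_mu].
    unfold pole_factor; auto_derive. generalize (one_minus_sqr_pos m Hm); lra.
Qed.

(** The Laplacian is the sum of the squares of the three rotation fields, which
    are the Hamiltonian fields of the Cartesian coordinates. *)
Lemma rLaplace_rpoisson f : rsmooth f -> eq_on_sphere (rLaplace f) (fun l m =>
  rpoisson coord_x (rpoisson coord_x f) l m + rpoisson coord_y (rpoisson coord_y f) l m
  + rpoisson coord_z (rpoisson coord_z f) l m).
Proof.
intros Hf l m Hm.
assert (H2 := one_minus_sqr_pos m Hm).
assert (S := sqrt_lt_R0 _ H2). assert (S2 := sqrt_sqrt _ (Rlt_le _ _ H2)).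
destruct (rsmooth_rd_lambda_rd_mu f Hf) as (k1 & k2 & _ & _ & Dk).
destruct (rsmooth_rd_lambda f Hf) as (Hl & _).
assert (e1 : ex_derive (fun t => rd_mu f t m) l) by (eexists; now apply Dk).
assert (e2 : ex_derive (fun t => rd_lambda f t m) l) by (eexists; now apply is_derive_rd_lambda).
assert (e3 := ex_derive_rd_mu f l m Hf Hm).
assert (e4 : ex_derive (fun t => rd_lambda f l t) m) by (eexists; now apply is_derive_rd_mu).
assert (Z : rpoisson coord_z (rpoisson coord_z f) l m = rd_lambda (rd_lambda f) l m).
{ rewrite rpoisson_coord_z.
  replace (rd_lambda (rpoisson coord_z f) l m) with (- rd_lambda (rd_lambda f) l m); [ring|].
  unfold rd_lambda at 1. rewrite <- Derive_opp. apply Derive_ext; intros t; now rewrite rpoisson_coord_z. }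
rewrite Z; clear Z.
rewrite (rpoisson_coord_x _ l m Hm), (rpoisson_coord_y _ l m Hm).
rewrite (rd_lambda_ext _ _ (rpoisson_coord_x f) l m Hm), (rd_mu_ext _ _ (rpoisson_coord_x f) l m Hm),
 (rd_lambda_ext _ _ (rpoisson_coord_y f) l m Hm), (rd_mu_ext _ _ (rpoisson_coord_y f) l m Hm).
set (r := sqrt (1 - m ^ 2)).
rewrite (Derive_mu_combination (fun t => rd_mu f l t) (fun t => rd_lambda f l t) (sin l) (cos l) m Hm e3 e4 : rd_mu _ l m = _).
rewrite (Derive_mu_combination (fun t => rd_mu f l t) (fun t => rd_lambda f l t) (- cos l) (sin l) m Hm e3 e4 : rd_mu _ l m = _).
rewrite (Derive_lambda_combination_x (fun t => rd_mu f t m) (fun t => rd_lambda f t m) r (m / r) l e1 e2 : rd_lambda _ l m = _).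
rewrite (Derive_lambda_combination_y (fun t => rd_mu f t m) (fun t => rd_lambda f t m) r (m / r) l e1 e2 : rd_lambda _ l m = _).
unfold rLaplace.
assert (E : rd_mu (fun l m => (1 - m ^ 2) * rd_mu f l m) l m =
  - 2 * m * rd_mu f l m + (1 - m ^ 2) * Derive (fun t => rd_mu f l t) m).
{ unfold rd_mu at 1. rewrite (Derive_mult (fun t => 1 - t ^ 2) (fun t => rd_mu f l t)).
  - replace (Derive (fun t => 1 - t ^ 2) m) with (- 2 * m); [ring|].
    symmetry; apply is_derive_unique; auto_derive; [easy|ring].
  - auto_derive; easy.
  - exact e3. }
rewrite E; clear E.
change (rd_lambda (rd_lambda f) l m) with (Derive (fun t => rd_lambda f t m) l).
set (Mm := Derive (fun t => rd_mu f l t) m).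
set (Lm := Derive (fun t => rd_lambda f l t) m).
set (Ml := Derive (fun t => rd_mu f t m) l).
set (Ll := Derive (fun t => rd_lambda f t m) l).
set (M := rd_mu f l m). set (L := rd_lambda f l m).
fold r in S, S2 |- *; clearbody r.
assert (SC : cos l ^ 2 = 1 - sin l ^ 2) by (generalize (sin2_cos2 l); unfold Rsqr; lra).
rewrite <- S2.
field_simplify_eq; [|lra].
ring_simplify.
rewrite ?SC. replace (m ^ 2) with (1 - r * r) by lra. ring.
Qed.

(** * Complex functions on the sphere *)

(** The real and imaginary parts of a complex function on the sphere. *)
Definition sf_re (f : sfun) : R -> R -> R := fun l m => Re (f l m).
Definition sf_im (f : sfun) : R -> R -> R := fun l m => Im (f l m).

Lemma smooth_on_sphereE f : smooth_on_sphere f <-> rsmooth (sf_re f) /\ rsmooth (sf_im f).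
Proof.
split.
- intros (F1 & F2 & H1 & H2 & E); split; [exists F1|exists F2]; split; try assumption;
   intros l m Hm; unfold sf_re, sf_im; now rewrite (E l m Hm).
- intros ((F1 & H1 & E1) & (F2 & H2 & E2)); exists F1, F2; split; [exact H1|split; [exact H2|]].
  intros l m Hm; generalize (E1 l m Hm) (E2 l m Hm); unfold sf_re, sf_im, pull.
  destruct (f l m) as (a, b); simpl; intros A B; now rewrite A, B.
Qed.

Lemma sfun_eqE f g : sfun_eq f g <-> eq_on_sphere (sf_re f) (sf_re g) /\ eq_on_sphere (sf_im f)
  (sf_im g).
Proof.
split.
- intros H; split; intros l m Hm; unfold sf_re, sf_im; now rewrite H.
- intros (A & B) l m Hm; generalize (A l m Hm) (B l m Hm); unfold sf_re, sf_im.
  destruct (f l m), (g l m); simpl; intros; now subst.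
Qed.

Lemma sfun_eq_trans f g h : sfun_eq f g -> sfun_eq g h -> sfun_eq f h.
Proof. intros H H' l m Hm; rewrite (H l m Hm); now apply H'. Qed.

Lemma smooth_ext f g : sfun_eq g f -> smooth_on_sphere f -> smooth_on_sphere g.
Proof.
rewrite sfun_eqE, !smooth_on_sphereE; intros (A & B) (C & D).
split; eapply rsmooth_ext; eassumption.
Qed.

Lemma re_poisson f g : sf_re (poisson f g) = fun l m =>
  rpoisson (sf_re f) (sf_re g) l m - rpoisson (sf_im f) (sf_im g) l m.
Proof.
do 2 (apply functional_extensionality; intro).
unfold sf_re, sf_im, poisson, sfun_minus, sfun_mult, d_lambda, d_mu, CDerive, rpoisson, rd_lambda, rd_mu; simpl; ring.
Qed.

Lemma im_poisson f g : sf_im (poisson f g) = fun l m =>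
  rpoisson (sf_re f) (sf_im g) l m + rpoisson (sf_im f) (sf_re g) l m.
Proof.
do 2 (apply functional_extensionality; intro).
unfold sf_re, sf_im, poisson, sfun_minus, sfun_mult, d_lambda, d_mu, CDerive, rpoisson, rd_lambda, rd_mu; simpl; ring.
Qed.

Lemma smooth_plus f g : smooth_on_sphere f -> smooth_on_sphere g ->
  smooth_on_sphere (sfun_plus f g).
Proof.
rewrite !smooth_on_sphereE; intros (A & B) (C & D).
split; [exact (rsmooth_plus _ _ A C)|exact (rsmooth_plus _ _ B D)].
Qed.

Lemma smooth_mult f g : smooth_on_sphere f -> smooth_on_sphere g ->
  smooth_on_sphere (sfun_mult f g).
Proof.
rewrite !smooth_on_sphereE; intros (A & B) (C & D).
split; [exact (rsmooth_minus _ _ (rsmooth_mult _ _ A C) (rsmooth_mult _ _ B D))|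
 exact (rsmooth_plus _ _ (rsmooth_mult _ _ A D) (rsmooth_mult _ _ B C))].
Qed.

Lemma smooth_const c : smooth_on_sphere (fun _ _ => c).
Proof. apply smooth_on_sphereE; split; apply rsmooth_const. Qed.

Lemma smooth_scal c f : smooth_on_sphere f -> smooth_on_sphere (sfun_scal c f).
Proof. intros H; exact (smooth_mult _ _ (smooth_const c) H). Qed.

Lemma smooth_poisson f g : smooth_on_sphere f -> smooth_on_sphere g ->
  smooth_on_sphere (poisson f g).
Proof.
rewrite !smooth_on_sphereE, re_poisson, im_poisson; intros (A & B) (C & D).
split; [apply rsmooth_minus|apply rsmooth_plus]; now apply rsmooth_rpoisson.
Qed.

Lemma poisson_ext f f' g g' : sfun_eq f f' -> sfun_eq g g' -> sfun_eq (poisson f g)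
  (poisson f' g').
Proof.
rewrite !sfun_eqE, !re_poisson, !im_poisson; intros (A & B) (C & D).
split; intros l m Hm.
- now rewrite (rpoisson_ext _ _ _ _ A C l m Hm), (rpoisson_ext _ _ _ _ B D l m Hm).
- now rewrite (rpoisson_ext _ _ _ _ A D l m Hm), (rpoisson_ext _ _ _ _ B C l m Hm).
Qed.

Lemma poisson_anti f g l m : poisson f g l m = (- poisson g f l m)%C.
Proof. unfold poisson, sfun_minus, sfun_mult; ring. Qed.

(** A real function as a complex one. *)
Definition ofR (h : R -> R -> R) : sfun := fun l m => RtoC (h l m).

Lemma smooth_ofR h : rsmooth h -> smooth_on_sphere (ofR h).
Proof. intros H; apply smooth_on_sphereE; split; [exact H|apply (rsmooth_const 0)]. Qed.

Lemma smooth_height : smooth_on_sphere height.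
Proof. apply (smooth_ofR coord_z), rsmooth_coord_z. Qed.

Lemma rpoisson_0 f l m : rpoisson (fun _ _ => 0) f l m = 0.
Proof. unfold rpoisson, rd_lambda, rd_mu; rewrite !Derive_const; ring. Qed.

Lemma re_poisson_ofR h f : sf_re (poisson (ofR h) f) = rpoisson h (sf_re f).
Proof.
rewrite re_poisson; do 2 (apply functional_extensionality; intro).
change (sf_im (ofR h)) with (fun _ _ : R => 0); rewrite rpoisson_0; apply Rminus_0_r.
Qed.

Lemma im_poisson_ofR h f : sf_im (poisson (ofR h) f) = rpoisson h (sf_im f).
Proof.
rewrite im_poisson; do 2 (apply functional_extensionality; intro).
change (sf_im (ofR h)) with (fun _ _ : R => 0); rewrite rpoisson_0; apply Rplus_0_r.
Qed.

(** The square of the Hamiltonian field of a real function. *)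
Definition square_bracket (h : R -> R -> R) (f : sfun) : sfun := poisson (ofR h) (poisson (ofR h) f).

Lemma smooth_square_bracket h f : rsmooth h -> smooth_on_sphere f ->
  smooth_on_sphere (square_bracket h f).
Proof.
intros Hh Hf; assert (H := smooth_ofR h Hh); unfold square_bracket.
apply smooth_poisson; [|apply smooth_poisson]; assumption.
Qed.

Lemma re_Laplace f : sf_re (Laplace_Beltrami f) = rLaplace (sf_re f).
Proof.
do 2 (apply functional_extensionality; intro).
unfold sf_re, Laplace_Beltrami, sfun_plus, d_mu, d_lambda, CDerive, rLaplace, rd_lambda, rd_mu; simpl.
f_equal; [apply Derive_ext; intros t|]; ring.
Qed.

Lemma im_Laplace f : sf_im (Laplace_Beltrami f) = rLaplace (sf_im f).
Proof.
do 2 (apply functional_extensionality; intro).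
unfold sf_im, Laplace_Beltrami, sfun_plus, d_mu, d_lambda, CDerive, rLaplace, rd_lambda, rd_mu; simpl.
f_equal; [apply Derive_ext; intros t|]; ring.
Qed.

Lemma Laplace_poisson f : smooth_on_sphere f -> sfun_eq (Laplace_Beltrami f)
  (sfun_plus (sfun_plus (square_bracket coord_x f) (square_bracket coord_y f)) (square_bracket coord_z f)).
Proof.
intros Hf; destruct (proj1 (smooth_on_sphereE f) Hf) as (A & B).
apply sfun_eqE; rewrite re_Laplace, im_Laplace; split.
- intros l m Hm; rewrite (rLaplace_rpoisson _ A l m Hm).
  rewrite <- !re_poisson_ofR; reflexivity.
- intros l m Hm; rewrite (rLaplace_rpoisson _ B l m Hm).
  rewrite <- !im_poisson_ofR; reflexivity.
Qed.

Lemma smooth_Laplace f : smooth_on_sphere f -> smooth_on_sphere (Laplace_Beltrami f).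
Proof.
intros H; apply (smooth_ext _ _ (Laplace_poisson f H)).
apply smooth_plus; [apply smooth_plus|]; apply smooth_square_bracket; try exact H;
  [apply rsmooth_coord_x|apply rsmooth_coord_y|apply rsmooth_coord_z].
Qed.

(** * The complex pairing *)

(** The integral of complex functions over the sphere. *)
Definition csphere_int (f : sfun) : C := (sphere_int (sf_re f), sphere_int (sf_im f)).

Lemma pairingE f g : pairing f g = csphere_int (sfun_mult f g).
Proof. reflexivity. Qed.

Lemma csphere_int_ext f g : sfun_eq f g -> csphere_int f = csphere_int g.
Proof.
rewrite sfun_eqE; intros (A & B); unfold csphere_int; now rewrite (sphere_int_ext _ _ A), (sphere_int_ext _ _ B).
Qed.

Lemma csphere_int_plus f g : smooth_on_sphere f -> smooth_on_sphere g ->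
  csphere_int (sfun_plus f g) = (csphere_int f + csphere_int g)%C.
Proof.
rewrite !smooth_on_sphereE; intros (A & B) (C & D).
unfold csphere_int, Cplus; simpl; f_equal; [exact (sphere_int_plus _ _ A C)|exact (sphere_int_plus _ _ B D)].
Qed.

Lemma csphere_int_scal c f : smooth_on_sphere f ->
  csphere_int (sfun_scal c f) = (c * csphere_int f)%C.
Proof.
rewrite !smooth_on_sphereE; intros (A & B).
unfold csphere_int, Cmult; simpl; f_equal.
- etransitivity; [exact (sphere_int_minus _ _ (rsmooth_scal (fst c) _ A) (rsmooth_scal (snd c) _ B))|].
  now rewrite !sphere_int_scal.
- etransitivity; [exact (sphere_int_plus _ _ (rsmooth_scal (fst c) _ B) (rsmooth_scal (snd c) _ A))|].
  now rewrite !sphere_int_scal.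
Qed.

Lemma pairing_sym f g : pairing f g = pairing g f.
Proof. apply csphere_int_ext; intros l m _; unfold sfun_mult; ring. Qed.

Lemma pairing_ext f f' g g' : sfun_eq f f' -> sfun_eq g g' -> pairing f g = pairing f' g'.
Proof.
intros H H'; apply csphere_int_ext; intros l m Hm; unfold sfun_mult.
now rewrite (H l m Hm), (H' l m Hm).
Qed.

Lemma pairing_plus_l f g h : smooth_on_sphere f -> smooth_on_sphere g -> smooth_on_sphere h ->
  pairing (sfun_plus f g) h = (pairing f h + pairing g h)%C.
Proof.
intros Hf Hg Hh; rewrite !pairingE, <- csphere_int_plus by now apply smooth_mult.
apply csphere_int_ext; intros l m _; unfold sfun_mult, sfun_plus; ring.
Qed.

Lemma pairing_scal_l c f h : smooth_on_sphere f -> smooth_on_sphere h ->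
  pairing (sfun_scal c f) h = (c * pairing f h)%C.
Proof.
intros Hf Hh; rewrite !pairingE, <- csphere_int_scal by now apply smooth_mult.
apply csphere_int_ext; intros l m _; unfold sfun_mult, sfun_scal; ring.
Qed.

Lemma pairing_plus_r f g h : smooth_on_sphere f -> smooth_on_sphere g -> smooth_on_sphere h ->
  pairing h (sfun_plus f g) = (pairing h f + pairing h g)%C.
Proof. intros; rewrite !(pairing_sym h); now apply pairing_plus_l. Qed.

Lemma pairing_scal_r c f h : smooth_on_sphere f -> smooth_on_sphere h ->
  pairing h (sfun_scal c f) = (c * pairing h f)%C.
Proof. intros; rewrite !(pairing_sym h); now apply pairing_scal_l. Qed.

(** Invariance of the pairing under brackets. *)
Lemma pairing_poisson h f g : smooth_on_sphere h -> smooth_on_sphere f -> smooth_on_sphere g ->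
  pairing h (poisson f g) = pairing (poisson h f) g.
Proof.
rewrite !smooth_on_sphereE; intros (h1 & h2) (f1 & f2) (g1 & g2).
assert (T := sphere_int_rpoisson_adjoint).
assert (M := fun a b c (A : rsmooth a) (B : rsmooth b) (C : rsmooth c) =>
   rsmooth_mult a (rpoisson b c) A (rsmooth_rpoisson b c B C)).
assert (M' := fun a b c (A : rsmooth a) (B : rsmooth b) (C : rsmooth c) =>
   rsmooth_mult (rpoisson a b) c (rsmooth_rpoisson a b A B) C).
rewrite !pairingE; unfold csphere_int; f_equal.
- transitivity (sphere_int (fun l m => (sf_re h l m * rpoisson (sf_re f) (sf_re g) l m
      - sf_re h l m * rpoisson (sf_im f) (sf_im g) l m)
      - (sf_im h l m * rpoisson (sf_re f) (sf_im g) l m + sf_im h l m * rpoisson (sf_im f) (sf_re g) l m))).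
  + apply sphere_int_ext; intros l m _.
    change (sf_re (sfun_mult h (poisson f g)) l m) with
      (sf_re h l m * sf_re (poisson f g) l m - sf_im h l m * sf_im (poisson f g) l m).
    rewrite re_poisson, im_poisson; ring.
  + rewrite !sphere_int_minus, sphere_int_plus by
      (repeat first [apply rsmooth_minus|apply rsmooth_plus|apply M; assumption]).
    rewrite !T by assumption.
    rewrite <- sphere_int_plus by (apply M'; assumption).
    rewrite <- !sphere_int_minus by
      (repeat first [apply rsmooth_minus|apply rsmooth_plus|apply M'; assumption]).
    apply sphere_int_ext; intros l m _.
    change (sf_re (sfun_mult (poisson h f) g) l m) with
      (sf_re (poisson h f) l m * sf_re g l m - sf_im (poisson h f) l m * sf_im g l m).
    rewrite re_poisson, im_poisson; ring.
- transitivity (sphere_int (fun l m => (sf_re h l m * rpoisson (sf_re f) (sf_im g) l m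
      + sf_re h l m * rpoisson (sf_im f) (sf_re g) l m)
      + (sf_im h l m * rpoisson (sf_re f) (sf_re g) l m - sf_im h l m * rpoisson (sf_im f) (sf_im g) l m))).
  + apply sphere_int_ext; intros l m _.
    change (sf_im (sfun_mult h (poisson f g)) l m) with
      (sf_re h l m * sf_im (poisson f g) l m + sf_im h l m * sf_re (poisson f g) l m).
    rewrite re_poisson, im_poisson; ring.
  + rewrite !sphere_int_plus, sphere_int_minus by
      (repeat first [apply rsmooth_minus|apply rsmooth_plus|apply M; assumption]).
    rewrite !T by assumption.
    rewrite <- sphere_int_minus by (apply M'; assumption).
    rewrite <- !sphere_int_plus by
      (repeat first [apply rsmooth_minus|apply rsmooth_plus|apply M'; assumption]).
    apply sphere_int_ext; intros l m _.
    change (sf_im (sfun_mult (poisson h f) g) l m) with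
      (sf_re (poisson h f) l m * sf_im g l m + sf_im (poisson h f) l m * sf_re g l m).
    rewrite re_poisson, im_poisson; ring.
Qed.

Lemma pairing_square_bracket h f g : rsmooth h -> smooth_on_sphere f -> smooth_on_sphere g ->
  pairing (square_bracket h f) g = pairing f (square_bracket h g).
Proof.
intros Hh Hf Hg; assert (H := smooth_ofR h Hh).
assert (Q := fun u => smooth_poisson (ofR h) u H).
assert (E : forall u v, smooth_on_sphere u -> smooth_on_sphere v ->
  pairing (poisson (ofR h) u) v = (- pairing u (poisson (ofR h) v))%C).
{ intros u v Hu Hv; rewrite pairing_poisson by assumption.
  rewrite (pairing_ext (poisson (ofR h) u) (sfun_scal (RtoC (-1)) (poisson u (ofR h))) v v);
   [|intros l m _; rewrite poisson_anti; unfold sfun_scal; ring|easy].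
  rewrite pairing_scal_l by (try apply smooth_poisson; assumption); ring. }
unfold square_bracket; rewrite !E by auto; ring.
Qed.

Lemma pairing_Laplace f g : smooth_on_sphere f -> smooth_on_sphere g ->
  pairing (Laplace_Beltrami f) g = pairing f (Laplace_Beltrami g).
Proof.
intros Hf Hg.
assert (Q := smooth_square_bracket).
assert (Hx := rsmooth_coord_x). assert (Hy := rsmooth_coord_y). assert (Hz := rsmooth_coord_z).
rewrite (pairing_ext _ _ g g (Laplace_poisson f Hf)) by easy.
rewrite (pairing_ext f f _ _ (fun _ _ _ => eq_refl) (Laplace_poisson g Hg)).
rewrite !pairing_plus_l, !pairing_plus_r by auto using smooth_plus.
now rewrite !pairing_square_bracket by assumption.
Qed.

Lemma smooth_minus f g : smooth_on_sphere f -> smooth_on_sphere g ->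
  smooth_on_sphere (sfun_minus f g).
Proof.
intros Hf Hg; apply (smooth_ext (sfun_plus f (sfun_scal (RtoC (-1)) g))).
- intros l m _; unfold sfun_minus, sfun_plus, sfun_scal; ring.
- apply smooth_plus; [|apply smooth_scal]; assumption.
Qed.

Lemma pairing_minus_l f g h : smooth_on_sphere f -> smooth_on_sphere g -> smooth_on_sphere h ->
  pairing (sfun_minus f g) h = (pairing f h - pairing g h)%C.
Proof.
intros Hf Hg Hh.
rewrite (pairing_ext _ (sfun_plus f (sfun_scal (RtoC (-1)) g)) h h);
 [|intros l m _; unfold sfun_minus, sfun_plus, sfun_scal; ring|easy].
rewrite pairing_plus_l, pairing_scal_l by (try apply smooth_scal; assumption); ring.
Qed.

Lemma smooth_Delta_theta alpha f : smooth_on_sphere f -> smooth_on_sphere (Delta_theta alpha f).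
Proof. intros H; apply smooth_minus; [now apply smooth_scal|now apply smooth_Laplace]. Qed.

(** The inertia operator is symmetric for the bilinear pairing. *)
Lemma pairing_Delta_theta alpha f g : smooth_on_sphere f -> smooth_on_sphere g ->
  pairing (Delta_theta alpha f) g = pairing f (Delta_theta alpha g).
Proof.
intros Hf Hg; assert (H1 := smooth_Laplace f Hf); assert (H2 := smooth_Laplace g Hg).
rewrite (pairing_sym f); unfold Delta_theta.
rewrite !pairing_minus_l, !pairing_scal_l by (try apply smooth_scal; assumption).
rewrite pairing_Laplace by assumption.
now rewrite (pairing_sym g f), (pairing_sym (Laplace_Beltrami g)).
Qed.

(** * Legendre functions *)

(** Real functions that have derivatives of all orders. *)
Definition infinitely_diff (g : R -> R) : Prop := forall n x, ex_derive_n g n x.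

Lemma infinitely_diff_is_derive g n x : infinitely_diff g ->
  is_derive (Derive_n g n) x (Derive_n g (S n) x).
Proof. intros H; apply Derive_correct; exact (H (S n) x). Qed.

Lemma infinitely_diff_Derive g : infinitely_diff g -> infinitely_diff (Derive g).
Proof.
intros H [|n] x; [exact I|].
generalize (H (S (S n)) x); simpl; apply ex_derive_ext; intros t; now rewrite Derive_n_Derive.
Qed.

Lemma is_derive_eq (f : R -> R) (x d d' : R) : is_derive f x d -> d = d' -> is_derive f x d'.
Proof. now intros H <-. Qed.

Lemma is_derive_quad_aux (a b c : R -> R) a' b' c' N M x :
  is_derive a x a' -> is_derive b x b' -> is_derive c x c' ->
  is_derive (fun x => (x ^ 2 - 1) * a x + 2 * N * x * b x + M * c x) x
    (2 * x * a x + (x ^ 2 - 1) * a' + 2 * N * b x + 2 * N * x * b' + M * c').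
Proof.
intros Ha Hb Hc.
assert (Ea := is_derive_unique _ _ _ Ha). assert (Eb := is_derive_unique _ _ _ Hb).
assert (Ec := is_derive_unique _ _ _ Hc).
auto_derive; [repeat split; eexists; eassumption|].
change (Derive (fun x => a x) x) with (Derive a x).
change (Derive (fun x => b x) x) with (Derive b x).
change (Derive (fun x => c x) x) with (Derive c x).
rewrite Ea, Eb, Ec; ring.
Qed.

Lemma is_derive_id_mult_aux (a b : R -> R) a' b' N x :
  is_derive a x a' -> is_derive b x b' ->
  is_derive (fun x => x * a x + N * b x) x (a x + x * a' + N * b').
Proof.
intros Ha Hb.
assert (Ea := is_derive_unique _ _ _ Ha). assert (Eb := is_derive_unique _ _ _ Hb).
auto_derive; [repeat split; eexists; eassumption|].
change (Derive (fun x => a x) x) with (Derive a x).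
change (Derive (fun x => b x) x) with (Derive b x).
rewrite Ea, Eb; ring.
Qed.

(** The Leibniz rule for a product with x^2 - 1. The truncated orders [n - 1]
    and [n - 2] are harmless, since their coefficients vanish when they are
    truncated. *)
Lemma is_derive_n_quad g n : infinitely_diff g ->
  (forall x, Derive_n (fun x => (x ^ 2 - 1) * g x) n x =
     (x ^ 2 - 1) * Derive_n g n x + 2 * INR n * x * Derive_n g (n - 1) x
     + INR n * (INR n - 1) * Derive_n g (n - 2) x) /\
  forall x, ex_derive_n (fun x => (x ^ 2 - 1) * g x) n x.
Proof.
intros H; induction n as [|n (IH & _)].
- split; [intros x; simpl; ring|easy].
- assert (D : forall x, is_derive (Derive_n (fun x => (x ^ 2 - 1) * g x) n) x
     ((x ^ 2 - 1) * Derive_n g (S n) x + 2 * INR (S n) * x * Derive_n g (S n - 1) x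
     + INR (S n) * (INR (S n) - 1) * Derive_n g (S n - 2) x)).
  { intros x. apply (is_derive_ext (fun x => (x ^ 2 - 1) * Derive_n g n x
      + 2 * INR n * x * Derive_n g (n - 1) x
      + INR n * (INR n - 1) * Derive_n g (n - 2) x)).
    { intros t; symmetry; apply IH. }
    assert (E := fun p => infinitely_diff_is_derive g p x H).
    rewrite S_INR.
    destruct n as [|[|k]].
    - eapply is_derive_eq; [exact (is_derive_quad_aux _ _ _ _ _ _ _ _ _ (E 0%nat) (E 0%nat) (E 0%nat))|].
      simpl INR; simpl Nat.sub; ring.
    - eapply is_derive_eq; [exact (is_derive_quad_aux _ _ _ _ _ _ _ _ _ (E 1%nat) (E 0%nat) (E 0%nat))|].
      simpl INR; simpl Nat.sub; ring.
    - replace (S (S (S k)) - 1)%nat with (S (S k)) by lia.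
      replace (S (S (S k)) - 2)%nat with (S k) by lia.
      replace (S (S k) - 1)%nat with (S k) by lia.
      replace (S (S k) - 2)%nat with k by lia.
      eapply is_derive_eq; [exact (is_derive_quad_aux _ _ _ _ _ _ _ _ _ (E (S (S k))) (E (S k)) (E k))|].
      rewrite !S_INR; ring. }
  split; [intros x; exact (is_derive_unique _ _ _ (D x))|intros x; eexists; apply D].
Qed.

(** The Leibniz rule for a product with the identity. *)
Lemma Derive_n_id_mult g n : infinitely_diff g ->
  forall x, Derive_n (fun x => x * g x) n x = x * Derive_n g n x + INR n * Derive_n g (n - 1) x.
Proof.
intros H; induction n as [|n IH]; intros x; [simpl; ring|].
change (Derive_n (fun x => x * g x) (S n) x) with
  (Derive (fun x => Derive_n (fun x => x * g x) n x) x).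
apply is_derive_unique.
apply (is_derive_ext (fun x => x * Derive_n g n x + INR n * Derive_n g (n - 1) x));
  [intros t; symmetry; apply IH|].
rewrite S_INR.
assert (E := fun p => infinitely_diff_is_derive g p x H).
destruct n as [|k].
- eapply is_derive_eq; [exact (is_derive_id_mult_aux _ _ _ _ _ _ (E 0%nat) (E 0%nat))|].
  simpl INR; simpl Nat.sub; ring.
- replace (S (S k) - 1)%nat with (S k) by lia.
  replace (S k - 1)%nat with k by lia.
  eapply is_derive_eq; [exact (is_derive_id_mult_aux _ _ _ _ _ _ (E (S k)) (E k))|]. ring.
Qed.

Lemma infinitely_diff_quad l : infinitely_diff (fun x => (x ^ 2 - 1) ^ l).
Proof.
induction l as [|l IH].
- intros [|n] x; [exact I|].
  apply (@ex_derive_ext R_AbsRing R_NormedModule (fun _ => Derive_n (fun _ => 1) n 0)).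
  2: apply ex_derive_const.
  intros t; simpl pow; destruct n; [easy|]; now rewrite !Derive_n_const.
- intros n x; apply (is_derive_n_quad (fun x => (x ^ 2 - 1) ^ l) n IH).
Qed.

(** The derivatives of (x^2 - 1)^l, which up to constants and powers of sqrt (1
    - x^2) are the Legendre functions. *)
Definition Rodrigues (l n : nat) : R -> R := Derive_n (fun x => (x ^ 2 - 1) ^ l) n.

Lemma is_derive_Rodrigues l n x : is_derive (Rodrigues l n) x (Rodrigues l (S n) x).
Proof. apply infinitely_diff_is_derive, infinitely_diff_quad. Qed.

(** The equation (x^2 - 1) u' = 2 l x u, differentiated p + 1 times. *)
Lemma Rodrigues_ODE l p x :
  (x ^ 2 - 1) * Rodrigues l (S (S p)) x + 2 * (INR p + 1) * x * Rodrigues l (S p) x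
  + (INR p + 1) * INR p * Rodrigues l p x
  = 2 * INR l * (x * Rodrigues l (S p) x + (INR p + 1) * Rodrigues l p x).
Proof.
set (u := fun x : R => (x ^ 2 - 1) ^ l).
assert (Iu : infinitely_diff u) by apply infinitely_diff_quad.
(* The equation to differentiate; for l = 0 both sides vanish. *)
assert (B : forall x, (x ^ 2 - 1) * Derive u x = 2 * INR l * (x * u x)).
{ intros t. assert (Du : is_derive u t (INR l * (2 * t) * (t ^ 2 - 1) ^ pred l)).
  { apply (is_derive_pow (fun x => x ^ 2 - 1) l t (2 * t)). auto_derive; [easy|ring]. }
  rewrite (is_derive_unique _ _ _ Du). unfold u; destruct l as [|l']; [simpl; ring|].
  simpl pred. rewrite <- (tech_pow_Rmult _ l'). ring. }
assert (E := Derive_n_ext _ _ (S p) x B).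
rewrite (proj1 (is_derive_n_quad (Derive u) (S p) (infinitely_diff_Derive u Iu))) in E.
rewrite Derive_n_scal_l, Derive_n_id_mult in E by exact Iu.
rewrite !Derive_n_Derive, S_INR in E.
replace (S p - 1)%nat with p in E by lia.
destruct p as [|p]; unfold Rodrigues; fold u.
- simpl INR in *. lra.
- replace (S (S p) - 2)%nat with p in E by lia. lra.
Qed.

Lemma Legendre_ODE l k x :
  (1 - x ^ 2) * Rodrigues l (S (S (l + k))) x - 2 * (INR k + 1) * x * Rodrigues l (S (l + k)) x
  + (INR l * (INR l + 1) - INR k * (INR k + 1)) * Rodrigues l (l + k) x = 0.
Proof. generalize (Rodrigues_ODE l (l + k) x); rewrite plus_INR; lra. Qed.

(** The polynomial (x^2 - 1)^l is monic of degree 2 l. *)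
Lemma Rodrigues_top l x :
  Rodrigues l (2 * l) x = INR (fact (2 * l)) /\ Rodrigues l (S (2 * l)) x = 0.
Proof.
assert (T : forall x, Rodrigues l (2 * l) x = INR (fact (2 * l))).
{ induction l as [|l IH]; intros t; [unfold Rodrigues; simpl; reflexivity|].
  assert (IH' : forall x, Rodrigues l (S (2 * l)) x = 0).
  { intros y; rewrite <- (is_derive_unique _ _ _ (is_derive_Rodrigues l (2 * l) y)).
    rewrite (Derive_ext _ _ y IH). apply Derive_const. }
  assert (IH2 : forall x, Rodrigues l (S (S (2 * l))) x = 0).
  { intros y; rewrite <- (is_derive_unique _ _ _ (is_derive_Rodrigues l (S (2 * l)) y)).
    rewrite (Derive_ext _ _ y IH'). apply Derive_const. }
  change (Rodrigues (S l) (2 * S l) t) with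
    (Derive_n (fun x => (x ^ 2 - 1) * (x ^ 2 - 1) ^ l) (2 * S l) t).
  rewrite (proj1 (is_derive_n_quad _ _ (infinitely_diff_quad l))).
  replace (2 * S l)%nat with (S (S (2 * l))) by lia.
  replace (S (S (2 * l)) - 1)%nat with (S (2 * l)) by lia.
  replace (S (S (2 * l)) - 2)%nat with (2 * l)%nat by lia.
  fold (Rodrigues l (S (S (2 * l)))); fold (Rodrigues l (S (2 * l))); fold (Rodrigues l (2 * l)).
  rewrite IH, IH', IH2, !fact_simpl, !mult_INR, !S_INR. ring. }
split; [apply T|].
rewrite <- (is_derive_unique _ _ _ (is_derive_Rodrigues l (2 * l) x)).
rewrite (Derive_ext _ _ x T). apply Derive_const.
Qed.

Lemma RInt_FTC (P q : R -> R) a b : (forall x, is_derive P x (q x)) ->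
  (forall x, ex_derive q x) -> RInt q a b = P b - P a.
Proof.
intros D C; apply is_RInt_unique.
apply (is_RInt_derive (V := R_CompleteNormedModule) P q); intros x _; [apply D|].
apply (@ex_derive_continuous R_AbsRing R_NormedModule), C.
Qed.

Lemma ex_RInt_of_derive (q : R -> R) a b : (forall x, ex_derive q x) -> ex_RInt q a b.
Proof.
intros C; apply (@ex_RInt_continuous R_CompleteNormedModule); intros x _.
apply (@ex_derive_continuous R_AbsRing R_NormedModule), C.
Qed.

Lemma is_derive_Rmult (f g : R -> R) (x a b : R) : is_derive f x a -> is_derive g x b ->
  is_derive (fun x => f x * g x) x (a * g x + f x * b).
Proof. intros Hf Hg; exact (is_derive_mult f g x a b Hf Hg Rmult_comm). Qed.

Lemma is_derive_weight k x :
  is_derive (fun x => (1 - x ^ 2) ^ k) x (INR k * (- 2 * x) * (1 - x ^ 2) ^ pred k).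
Proof. apply (is_derive_pow (fun x => 1 - x ^ 2) k x (- 2 * x)). auto_derive; [easy|ring]. Qed.

(** The integral that the norms of the Legendre functions of top order reduce
    to. *)
Definition wallis (l : nat) : R := RInt (fun x => (1 - x ^ 2) ^ l) (-1) 1.

Lemma wallis_S l : (2 * INR l + 3) * wallis (S l) = (2 * INR l + 2) * wallis l.
Proof.
assert (A : forall l x, ex_derive (fun x => (1 - x ^ 2) ^ l) x) by (intros; auto_derive; easy).
assert (E : RInt (fun x => (2 * INR l + 3) * (1 - x ^ 2) ^ S l
   - (2 * INR l + 2) * (1 - x ^ 2) ^ l) (-1) 1 = 0).
(* Integration of the derivative of x (1 - x^2)^(l + 1). *)
{ rewrite (RInt_FTC (fun x => x * (1 - x ^ 2) ^ S l)).
  - simpl; ring.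
  - intros x. eapply is_derive_eq.
    + exact (is_derive_Rmult (fun x => x) _ x _ _ (is_derive_id x) (is_derive_weight (S l) x)).
    + rewrite S_INR; simpl pred; simpl pow. unfold one; simpl; ring.
  - intros x; auto_derive; easy. }
rewrite (RInt_minus (V := R_CompleteNormedModule)
  (fun x => (2 * INR l + 3) * (1 - x ^ 2) ^ S l) (fun x => (2 * INR l + 2) * (1 - x ^ 2) ^ l)) in E
  by (apply ex_RInt_of_derive; intros; auto_derive; easy).
rewrite (RInt_scal (V := R_CompleteNormedModule) (fun x => (1 - x ^ 2) ^ S l)) in E
  by (apply ex_RInt_of_derive; intros; auto_derive; easy).
rewrite (RInt_scal (V := R_CompleteNormedModule) (fun x => (1 - x ^ 2) ^ l)) in E
  by (apply ex_RInt_of_derive; intros; auto_derive; easy).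
change ((2 * INR l + 3) * wallis (S l) - (2 * INR l + 2) * wallis l = 0) in E. lra.
Qed.

Lemma wallisE l : wallis l * INR (fact (2 * l)) * (2 * INR l + 1) = 2 * (2 ^ l * INR (fact l)) ^ 2.
Proof.
induction l as [|l IH].
- unfold wallis. simpl pow. rewrite RInt_const. unfold scal; simpl; unfold mult; simpl. ring.
- assert (W := wallis_S l).
  replace (2 * S l)%nat with (S (S (2 * l))) by lia.
  rewrite !fact_simpl, !mult_INR, !S_INR, mult_INR. simpl (INR 2).
  replace (wallis (S l) * (((1 + 1) * INR l + 1 + 1) * (((1 + 1) * INR l + 1) * INR (fact (2 * l)))) *
    (2 * (INR l + 1) + 1)) with
    (((2 * INR l + 3) * wallis (S l)) * (2 * INR l + 2) * (INR (fact (2 * l)) * (2 * INR l + 1))) by ring.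
  rewrite W.
  replace ((2 * INR l + 2) * wallis l * (2 * INR l + 2) * (INR (fact (2 * l)) * (2 * INR l + 1)))
   with ((2 * INR l + 2) ^ 2 * (wallis l * INR (fact (2 * l)) * (2 * INR l + 1))) by ring.
  rewrite IH. simpl pow. ring.
Qed.

(** The squared norm of the Legendre function of degree l and order k, without
    its normalisation. *)
Definition Legendre_norm (l k : nat) : R := RInt (fun x => (1 - x ^ 2) ^ k * Rodrigues l (l + k) x ^ 2) (-1) 1.

Lemma ex_derive_Rodrigues l n x : ex_derive (fun x => Rodrigues l n x) x.
Proof. eexists; apply is_derive_Rodrigues. Qed.

(** Integration of the derivative of (1 - x^2)^(k + 1) w' w, where w is the
    polynomial of order k: its values at the end points vanish, and by the
    Legendre equation ((1 - x^2)^(k + 1) w')' is a multiple of (1 - x^2)^k w. *)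
Lemma Legendre_norm_S l k :
  Legendre_norm l (S k) = (INR l * (INR l + 1) - INR k * (INR k + 1)) * Legendre_norm l k.
Proof.
set (c := INR l * (INR l + 1) - INR k * (INR k + 1)).
assert (A : forall k n x, ex_derive (fun x => (1 - x ^ 2) ^ k * Rodrigues l n x ^ 2) x).
{ intros j n x; apply ex_derive_mult; [eexists; apply is_derive_weight|].
  apply (ex_derive_pow (fun x => Rodrigues l n x)), ex_derive_Rodrigues. }
assert (E : RInt (fun x => (1 - x ^ 2) ^ S k * Rodrigues l (l + S k) x ^ 2
   - c * ((1 - x ^ 2) ^ k * Rodrigues l (l + k) x ^ 2)) (-1) 1 = 0).
{ rewrite (RInt_FTC (fun x => (1 - x ^ 2) ^ S k * Rodrigues l (S (l + k)) x * Rodrigues l (l + k) x)).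
  - simpl; ring.
  - intros x. eapply is_derive_eq.
    { exact (is_derive_Rmult _ _ x _ _ (is_derive_Rmult _ _ x _ _ (is_derive_weight (S k) x)
        (is_derive_Rodrigues l (S (l + k)) x)) (is_derive_Rodrigues l (l + k) x)). }
    rewrite Nat.add_succ_r, S_INR. simpl pred.
    assert (O : c * Rodrigues l (l + k) x = - (1 - x ^ 2) * Rodrigues l (S (S (l + k))) x
      + 2 * (INR k + 1) * x * Rodrigues l (S (l + k)) x)
     by (unfold c; generalize (Legendre_ODE l k x); lra).
    replace (c * ((1 - x ^ 2) ^ k * Rodrigues l (l + k) x ^ 2)) with
      (c * Rodrigues l (l + k) x * ((1 - x ^ 2) ^ k * Rodrigues l (l + k) x)) by ring.
    rewrite O. simpl pow. ring.
  - intros x; apply (@ex_derive_minus R_AbsRing R_NormedModule); [apply A|].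
    apply ex_derive_scal, A. }
rewrite (RInt_minus (V := R_CompleteNormedModule)
  (fun x => (1 - x ^ 2) ^ S k * Rodrigues l (l + S k) x ^ 2)
  (fun x => c * ((1 - x ^ 2) ^ k * Rodrigues l (l + k) x ^ 2))) in E
  by (apply ex_RInt_of_derive; intros; first [exact (A _ _ _)|exact (ex_derive_scal _ c _ (A _ _ _))]).
rewrite (RInt_scal (V := R_CompleteNormedModule)
  (fun x => (1 - x ^ 2) ^ k * Rodrigues l (l + k) x ^ 2)) in E
  by (apply ex_RInt_of_derive; intros; apply A).
change (Legendre_norm l (S k) - c * Legendre_norm l k = 0) in E. lra.
Qed.

Lemma Legendre_norm_rec l k : (k <= l)%nat ->
  Legendre_norm l k * INR (fact (l - k)) * INR (fact l) = INR (fact (l + k)) * Legendre_norm l 0 * INR (fact l).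
Proof.
induction k as [|k IH]; intros Hk.
- rewrite Nat.sub_0_r, Nat.add_0_r; ring.
- specialize (IH ltac:(lia)). rewrite Legendre_norm_S, Nat.add_succ_r, fact_simpl, mult_INR.
  replace (l - k)%nat with (S (l - S k)) in IH by lia.
  rewrite fact_simpl, mult_INR in IH.
  assert (E : INR (S (l - S k)) = INR l - INR k).
  { rewrite <- minus_INR by lia. f_equal; lia. }
  rewrite E in IH. rewrite S_INR, plus_INR.
  replace (INR l * (INR l + 1) - INR k * (INR k + 1)) with
    ((INR l + INR k + 1) * (INR l - INR k)) by ring.
  transitivity ((INR l + INR k + 1) *
    (Legendre_norm l k * ((INR l - INR k) * INR (fact (l - S k))) * INR (fact l))); [ring|].
  rewrite IH; ring.
Qed.

(** The norms of all orders are known from the one of order l, for which the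
    polynomial is constant. *)
Lemma Legendre_normE l k : (k <= l)%nat ->
  Legendre_norm l k * INR (fact (l - k)) * (2 * INR l + 1) =
  2 * (2 ^ l * INR (fact l)) ^ 2 * INR (fact (l + k)).
Proof.
intros Hk.
assert (F := INR_fact_neq_0).
assert (E1 := Legendre_norm_rec l k Hk). assert (E2 := Legendre_norm_rec l l (le_n l)).
apply Rmult_eq_reg_r in E1; [|apply F]. apply Rmult_eq_reg_r in E2; [|apply F].
rewrite Nat.sub_diag in E2. simpl (INR (fact 0)) in E2.
replace (l + l)%nat with (2 * l)%nat in E2 by lia.
assert (E3 : Legendre_norm l l = INR (fact (2 * l)) ^ 2 * wallis l).
{ unfold Legendre_norm, wallis.
  rewrite <- (RInt_scal (V := R_CompleteNormedModule) (fun x => (1 - x ^ 2) ^ l))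
    by (apply ex_RInt_of_derive; intros; auto_derive; easy).
  apply RInt_ext; intros x _.
  replace (l + l)%nat with (2 * l)%nat by lia. rewrite (proj1 (Rodrigues_top l x)).
  unfold scal; simpl; unfold mult; simpl. ring. }
rewrite E3 in E2.
assert (E4 : Legendre_norm l 0 = INR (fact (2 * l)) * wallis l).
{ apply (Rmult_eq_reg_l (INR (fact (2 * l)))); [|apply F]. lra. }
rewrite E1, E4, <- wallisE. ring.
Qed.

(** * Spherical harmonics *)

Lemma is_derive_sqrt_pow k m : -1 < m < 1 ->
  is_derive (fun t => sqrt (1 - t ^ 2) ^ k) m
    (- (INR k * m) / (1 - m ^ 2) * sqrt (1 - m ^ 2) ^ k).
Proof.
intros Hm; assert (H2 := one_minus_sqr_pos m Hm).
assert (S := sqrt_lt_R0 _ H2). assert (S2 := sqrt_sqrt _ (Rlt_le _ _ H2)).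
eapply is_derive_eq; [exact (is_derive_pow (fun t => sqrt (1 - t ^ 2)) k m _ (is_derive_sqrt_mu m Hm))|].
set (r := sqrt (1 - m ^ 2)) in *; clearbody r.
assert (R0 : r <> 0) by lra.
rewrite <- S2; destruct k as [|k].
- simpl INR; field; exact R0.
- simpl pred; rewrite <- tech_pow_Rmult; field; exact R0.
Qed.

Lemma is_derive_Legendre l k m : -1 < m < 1 ->
  is_derive (Legendre_assoc l k) m (sqrt (1 - m ^ 2) ^ k / (2 ^ l * INR (fact l)) *
    (Rodrigues l (S (l + k)) m - INR k * m / (1 - m ^ 2) * Rodrigues l (l + k) m)).
Proof.
intros Hm; assert (H2 := one_minus_sqr_pos m Hm).
assert (F := INR_fact_neq_0 l). assert (P2 : 2 ^ l <> 0) by (apply pow_nonzero; lra).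
apply (is_derive_ext (fun t => / (2 ^ l * INR (fact l)) * (sqrt (1 - t ^ 2) ^ k * Rodrigues l (l + k) t))).
{ intros t; unfold Legendre_assoc, Rodrigues; toR; field; split; assumption. }
eapply is_derive_eq.
- exact (is_derive_scal _ m (/ (2 ^ l * INR (fact l))) _ (is_derive_Rmult _ _ _ _ _
    (is_derive_sqrt_pow k m Hm) (is_derive_Rodrigues l (l + k) m))).
- cbv beta; toR; field; repeat split; try assumption; lra.
Qed.

(** The associated Legendre equation. *)
Lemma Legendre_assoc_ODE l k m : -1 < m < 1 ->
  Derive (fun t => (1 - t ^ 2) * Derive (Legendre_assoc l k) t) m =
  (INR k ^ 2 / (1 - m ^ 2) - INR l * (INR l + 1)) * Legendre_assoc l k m.
Proof.
intros Hm; assert (H2 := one_minus_sqr_pos m Hm).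
assert (F := INR_fact_neq_0 l). assert (P2 : 2 ^ l <> 0) by (apply pow_nonzero; lra).
set (A := / (2 ^ l * INR (fact l))).
apply is_derive_unique.
apply (is_derive_ext_loc (fun t => sqrt (1 - t ^ 2) ^ k *
  (A * ((1 - t ^ 2) * Rodrigues l (S (l + k)) t - INR k * t * Rodrigues l (l + k) t)))).
{ apply (locally_height _ m Hm); intros t Ht.
  rewrite (is_derive_unique _ _ _ (is_derive_Legendre l k t Ht)).
  assert (T2 := one_minus_sqr_pos t Ht). unfold A; toR; field; repeat split; try assumption; lra. }
assert (D1 := is_derive_Rmult (fun t => 1 - t ^ 2) _ m (- 2 * m) _
  ltac:(auto_derive; [easy|ring]) (is_derive_Rodrigues l (S (l + k)) m)).
assert (D2 := is_derive_Rmult (fun t => INR k * t) _ m (INR k) _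
  ltac:(auto_derive; [easy|ring]) (is_derive_Rodrigues l (l + k) m)).
eapply is_derive_eq.
- exact (is_derive_Rmult _ _ m _ _ (is_derive_sqrt_pow k m Hm)
   (is_derive_scal _ m A _ (@is_derive_minus R_AbsRing R_NormedModule _ _ _ _ _ D1 D2))).
- assert (O := Legendre_ODE l k m).
  unfold Legendre_assoc. fold (Rodrigues l (l + k)). unfold minus, plus, opp; simpl.
  set (w2 := Rodrigues l (S (S (l + k))) m) in *. set (w1 := Rodrigues l (S (l + k)) m) in *.
  set (w0 := Rodrigues l (l + k) m) in *. set (s := sqrt _ ^ k).
  replace (/ A) with (2 ^ l * INR (fact l)) by (unfold A; rewrite Rinv_inv; reflexivity).
  unfold Rdiv at 3. fold A.
  assert (E : m ^ 2 <> 1) by lra.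
  assert (O' : (1 - m ^ 2) * w2 = 2 * (INR k + 1) * m * w1
     - (INR l * (INR l + 1) - INR k * (INR k + 1)) * w0) by lra.
  clear O. toR.
  transitivity (s * A * ((1 - m ^ 2) * w2 - 2 * m * w1 - 2 * INR k * m * w1
     - INR k * w0 + INR k ^ 2 * m ^ 2 / (1 - m ^ 2) * w0)).
  + field. lra.
  + rewrite O'. field. lra.
Qed.

(** The Laplacian in separated variables. *)
Lemma rLaplace_separated q T l m : rLaplace (fun l m => q m * T l) l m =
  Derive (fun t => (1 - t ^ 2) * Derive q t) m * T l + / (1 - m ^ 2) * (q m * Derive (Derive T) l).
Proof.
unfold rLaplace, rd_mu, rd_lambda; f_equal.
- rewrite <- Derive_scal_l; apply Derive_ext; intros t.
  rewrite Derive_scal_l; ring.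
- f_equal. rewrite <- Derive_scal; apply Derive_ext; intros t. apply Derive_scal.
Qed.

Lemma Derive_cos_lin j l : Derive (fun t => cos (j * t)) l = - j * sin (j * l).
Proof. apply is_derive_unique; auto_derive; [easy|ring]. Qed.

Lemma Derive_sin_lin j l : Derive (fun t => sin (j * t)) l = j * cos (j * l).
Proof. apply is_derive_unique; auto_derive; [easy|ring]. Qed.

Lemma Derive2_cos j l : Derive (Derive (fun t => cos (j * t))) l = - j ^ 2 * cos (j * l).
Proof.
rewrite (Derive_ext _ (fun t => - j * sin (j * t)) l (Derive_cos_lin j)), Derive_scal, Derive_sin_lin.
ring.
Qed.

Lemma Derive2_sin j l : Derive (Derive (fun t => sin (j * t))) l = - j ^ 2 * sin (j * l).
Proof.
rewrite (Derive_ext _ (fun t => j * cos (j * t)) l (Derive_sin_lin j)), Derive_scal, Derive_cos_lin.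
ring.
Qed.

(** The dependence of a spherical harmonic on the height. *)
Definition Y_profile (l : nat) (m : Z) (mu : R) : R := Y_coef l m * Legendre_assoc l (Z.abs_nat m) mu.

Lemma re_Y l m : sf_re (Y l m) = fun lambda mu => Y_profile l m mu * cos (IZR m * lambda).
Proof.
do 2 (apply functional_extensionality; intro); unfold sf_re, Y, Y_profile; simpl; ring.
Qed.

Lemma im_Y l m : sf_im (Y l m) = fun lambda mu => Y_profile l m mu * sin (IZR m * lambda).
Proof.
do 2 (apply functional_extensionality; intro); unfold sf_im, Y, Y_profile; simpl; ring.
Qed.

Lemma IZR_abs_nat m : IZR m = INR (Z.abs_nat m) \/ IZR m = - INR (Z.abs_nat m).
Proof.
rewrite INR_IZR_INZ, Zabs2Nat.id_abs.
destruct (Z.abs_eq_or_opp m) as [-> | ->]; [now left|right; rewrite opp_IZR; ring].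
Qed.

Lemma IZR_abs_nat_sqr m : IZR m ^ 2 = INR (Z.abs_nat m) ^ 2.
Proof. destruct (IZR_abs_nat m) as [-> | ->]; ring. Qed.

(** The real and imaginary parts of (x + i y)^k. *)
Lemma rsmooth_power k :
  rsmooth (fun l m => sqrt (1 - m ^ 2) ^ k * cos (INR k * l)) /\
  rsmooth (fun l m => sqrt (1 - m ^ 2) ^ k * sin (INR k * l)).
Proof.
induction k as [|k (IC & IS)].
- split.
  + apply (rsmooth_ext (fun _ _ => 1)); [|apply rsmooth_const].
    intros l m _; simpl; rewrite Rmult_0_l, cos_0; ring.
  + apply (rsmooth_ext (fun _ _ => 0)); [|apply rsmooth_const].
    intros l m _; simpl; rewrite Rmult_0_l, sin_0; ring.
- split.
  + eapply rsmooth_ext; [|exact (rsmooth_minus _ _ (rsmooth_mult _ _ IC rsmooth_coord_x)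
      (rsmooth_mult _ _ IS rsmooth_coord_y))].
    intros l m _; rewrite S_INR, Rmult_plus_distr_r, Rmult_1_l, cos_plus; unfold coord_x, coord_y; simpl; ring.
  + eapply rsmooth_ext; [|exact (rsmooth_plus _ _ (rsmooth_mult _ _ IS rsmooth_coord_x)
      (rsmooth_mult _ _ IC rsmooth_coord_y))].
    intros l m _; rewrite S_INR, Rmult_plus_distr_r, Rmult_1_l, sin_plus; unfold coord_x, coord_y; simpl; ring.
Qed.

Lemma rsmooth_Zfun phi : infinitely_diff phi -> rsmooth (fun _ m => phi m).
Proof.
intros H; exists (fun _ _ z => phi z); split; [now apply smooth3_Zfun|now intros l m _].
Qed.

Lemma infinitely_diff_Rodrigues l n : infinitely_diff (Rodrigues l n).
Proof.
induction n as [|n IH]; [exact (infinitely_diff_quad l)|exact (infinitely_diff_Derive _ IH)].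
Qed.

(** A spherical harmonic is a polynomial in the height times a power of x + i y
    or x - i y. *)
Lemma smooth_Y l m : smooth_on_sphere (Y l m).
Proof.
apply smooth_on_sphereE; rewrite re_Y, im_Y.
set (k := Z.abs_nat m).
destruct (rsmooth_power k) as (HC & HS).
assert (HR := rsmooth_scal (Y_coef l m / (2 ^ l * INR (fact l))) _
  (rsmooth_Zfun _ (infinitely_diff_Rodrigues l (l + k)))).
assert (Q : forall mu, Y_profile l m mu = Y_coef l m / (2 ^ l * INR (fact l)) * Rodrigues l (l + k) mu
   * sqrt (1 - mu ^ 2) ^ k).
{ intros mu; unfold Y_profile, Legendre_assoc, Rodrigues, Rdiv; fold k; ring. }
split.
- eapply rsmooth_ext; [|exact (rsmooth_mult _ _ HR HC)].
  intros x mu _; rewrite Q; destruct (IZR_abs_nat m) as [-> | ->]; fold k.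
  + ring.
  + replace (- INR k * x) with (- (INR k * x)) by ring; rewrite cos_neg; ring.
- destruct (IZR_abs_nat m) as [E | E]; fold k in E; rewrite E.
  + eapply rsmooth_ext; [|exact (rsmooth_mult _ _ HR HS)].
    intros x mu _; rewrite Q; ring.
  + eapply rsmooth_ext; [|exact (rsmooth_scal (-1) _ (rsmooth_mult _ _ HR HS))].
    intros x mu _; rewrite Q.
    replace (- INR k * x) with (- (INR k * x)) by ring; rewrite sin_neg; ring.
Qed.

Lemma Laplace_Y l m : sfun_eq (Laplace_Beltrami (Y l m))
  (sfun_scal (RtoC (- (INR l * (INR l + 1)))) (Y l m)).
Proof.
assert (E : forall mu, -1 < mu < 1 -> Derive (fun t => (1 - t ^ 2) * Derive (Y_profile l m) t) mu =
  (IZR m ^ 2 / (1 - mu ^ 2) - INR l * (INR l + 1)) * Y_profile l m mu).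
{ intros mu Hmu; unfold Y_profile.
  rewrite (Derive_ext _ (fun t => Y_coef l m *
    ((1 - t ^ 2) * Derive (Legendre_assoc l (Z.abs_nat m)) t))).
  - rewrite Derive_scal, Legendre_assoc_ODE, <- IZR_abs_nat_sqr by assumption; ring.
  - intros t; rewrite Derive_scal; ring. }
apply sfun_eqE; rewrite re_Laplace, im_Laplace, re_Y, im_Y; split; intros x mu Hmu;
 rewrite (rLaplace_separated (Y_profile l m)), E by assumption.
- rewrite Derive2_cos; transitivity (- (INR l * (INR l + 1)) * sf_re (Y l m) x mu).
  + rewrite re_Y; field; generalize (one_minus_sqr_pos mu Hmu); lra.
  + unfold sf_re, sfun_scal; simpl; ring.
- rewrite Derive2_sin; transitivity (- (INR l * (INR l + 1)) * sf_im (Y l m) x mu).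
  + rewrite im_Y; field; generalize (one_minus_sqr_pos mu Hmu); lra.
  + unfold sf_im, sfun_scal; simpl; ring.
Qed.

Lemma Delta_theta_Y alpha l m : sfun_eq (Delta_theta alpha (Y l m))
  (sfun_scal (RtoC (alpha ^ 2 + INR l * (INR l + 1))) (Y l m)).
Proof.
intros x mu Hmu; unfold Delta_theta, sfun_minus.
rewrite (Laplace_Y l m x mu Hmu); unfold sfun_scal.
rewrite (RtoC_plus (alpha ^ 2)), RtoC_opp; ring.
Qed.

Lemma Laplace_height : sfun_eq (Laplace_Beltrami height) (sfun_scal (RtoC (- 2)) height).
Proof.
apply sfun_eqE; rewrite re_Laplace, im_Laplace; split; intros x mu Hmu.
- change (sf_re height) with (fun (_ : R) (m : R) => m).
  transitivity (rLaplace (fun l m => m * (fun _ => 1) l) x mu).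
  { f_equal; do 2 (apply functional_extensionality; intro); ring. }
  rewrite (rLaplace_separated (fun m => m) (fun _ => 1)).
  rewrite (Derive_ext _ (fun t => 1 - t ^ 2)) by (intros t; rewrite Derive_id; ring).
  rewrite (Derive_ext (Derive (fun _ => 1)) (fun _ => 0)) by (intros t; apply Derive_const).
  rewrite Derive_const.
  replace (Derive (fun t => 1 - t ^ 2) mu) with (- 2 * mu).
  + unfold sf_re, sfun_scal, height; simpl; ring.
  + symmetry; apply is_derive_unique; auto_derive; [easy|ring].
- change (sf_im height) with (fun _ _ : R => 0).
  transitivity (rLaplace (fun l m => (fun _ => 0) m * (fun _ => 0) l) x mu).
  { f_equal; do 2 (apply functional_extensionality; intro); ring. }
  rewrite (rLaplace_separated (fun _ => 0) (fun _ => 0)).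
  unfold sf_im, sfun_scal, height; simpl; ring.
Qed.

Lemma Delta_theta_height alpha : sfun_eq (Delta_theta alpha height)
  (sfun_scal (RtoC (alpha ^ 2 + 2)) height).
Proof.
intros x mu Hmu; unfold Delta_theta, sfun_minus.
rewrite (Laplace_height x mu Hmu); unfold sfun_scal.
replace (RtoC (- 2)) with (- RtoC 2)%C by (rewrite <- RtoC_opp; f_equal; ring).
rewrite (RtoC_plus (alpha ^ 2)); ring.
Qed.

(** Bracketing with the height is differentiation along the parallels. *)
Lemma poisson_height f : poisson f height = d_lambda f.
Proof.
do 2 (apply functional_extensionality; intro).
unfold poisson, sfun_minus, sfun_mult.
replace (d_mu height x x0) with (RtoC 1).
- replace (d_lambda height x x0) with (RtoC 0); [ring|].
  unfold d_lambda, CDerive, height; simpl; rewrite !Derive_const; reflexivity.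
- unfold d_mu, CDerive, height; simpl; rewrite Derive_id, Derive_const; reflexivity.
Qed.

Lemma poisson_Y_height l m : poisson (Y l m) height = sfun_scal (Ci * RtoC (IZR m))%C (Y l m).
Proof.
rewrite poisson_height; do 2 (apply functional_extensionality; intro).
unfold d_lambda, CDerive.
change (fun s => Re (Y l m s x0)) with (fun s => sf_re (Y l m) s x0).
change (fun s => Im (Y l m s x0)) with (fun s => sf_im (Y l m) s x0).
rewrite re_Y, im_Y, !Derive_scal, Derive_cos_lin, Derive_sin_lin.
unfold sfun_scal, Y, Y_profile, Cmult, RtoC, Ci; simpl; f_equal; ring.
Qed.

Lemma sin_2PI_Z j : sin (IZR j * (2 * PI)) = 0.
Proof. apply sin_eq_0_1; exists (2 * j)%Z; rewrite mult_IZR; ring. Qed.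

Lemma cos_2PI_Z j : cos (IZR j * (2 * PI)) = 1.
Proof.
replace (IZR j * (2 * PI)) with (2 * (IZR j * PI)) by ring.
rewrite cos_2a_sin, (sin_eq_0_1 (IZR j * PI)) by now exists j. ring.
Qed.

(** A function of nonzero frequency in the longitude has integral zero. *)
Lemma csphere_int_phase g q j : j <> 0%Z ->
  sfun_eq g (fun l m => (RtoC (q m) * (cos (IZR j * l), sin (IZR j * l)))%C) -> csphere_int g = RtoC 0.
Proof.
intros Hj Hg; rewrite (csphere_int_ext _ _ Hg); unfold csphere_int, RtoC.
assert (J : IZR j <> 0) by now apply not_0_IZR.
assert (Z : forall h, (forall m, parallel_int h m = 0) -> sphere_int h = 0).
{ intros h Hh; unfold sphere_int; rewrite (RInt_ext _ (fun _ => 0)) by (intros; apply Hh).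
  rewrite RInt_const; apply Rmult_0_r. }
f_equal; apply Z; intros m; unfold parallel_int, sf_re, sf_im; simpl.
- rewrite (RInt_FTC (fun l => q m * sin (IZR j * l) / IZR j)).
  + rewrite sin_2PI_Z, (Rmult_0_r (IZR j)), sin_0; field; exact J.
  + intros l; auto_derive; [easy|field; exact J].
  + intros l; auto_derive; easy.
- rewrite (RInt_FTC (fun l => - q m * cos (IZR j * l) / IZR j)).
  + rewrite cos_2PI_Z, (Rmult_0_r (IZR j)), cos_0; field; exact J.
  + intros l; auto_derive; [easy|field; exact J].
  + intros l; auto_derive; easy.
Qed.

Lemma pairing_Y_0 l m l' m' : (m + m' <> 0)%Z -> pairing (Y l m) (Y l' m') = RtoC 0.
Proof.
intros H; rewrite pairingE.
apply (csphere_int_phase _ (fun mu => Y_profile l m mu * Y_profile l' m' mu) (m + m') H).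
intros x mu _; unfold sfun_mult, Y.
rewrite plus_IZR, Rmult_plus_distr_r, cos_plus, sin_plus.
unfold Y_profile, Cmult, RtoC; simpl; f_equal; ring.
Qed.

Lemma pairing_height_Y l m : m <> 0%Z -> pairing height (Y l m) = RtoC 0.
Proof.
intros H; rewrite pairingE.
apply (csphere_int_phase _ (fun mu => mu * Y_profile l m mu) m H).
intros x mu _; unfold sfun_mult, Y, height.
unfold Y_profile, Cmult, RtoC; simpl; f_equal; ring.
Qed.

Lemma csphere_int_profile g q : sfun_eq g (fun l m => RtoC (q m)) ->
  (forall x, ex_derive q x) -> csphere_int g = RtoC (2 * PI * RInt q (-1) 1).
Proof.
intros Hg Hq; rewrite (csphere_int_ext _ _ Hg); unfold csphere_int, RtoC.
f_equal; unfold sphere_int, parallel_int, sf_re, sf_im; simpl.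
- rewrite <- (RInt_scal (V := R_CompleteNormedModule) q) by now apply ex_RInt_of_derive.
  apply RInt_ext; intros m _; rewrite RInt_const; unfold scal; simpl; unfold mult; simpl; ring.
- rewrite (RInt_ext _ (fun _ => 0)).
  + rewrite RInt_const; apply Rmult_0_r.
  + intros m _; rewrite RInt_const; apply Rmult_0_r.
Qed.

Lemma pairing_height_height : pairing height height = RtoC (4 * PI / 3).
Proof.
rewrite pairingE, (csphere_int_profile _ (fun m => m ^ 2)).
- f_equal. rewrite (RInt_FTC (fun m => m ^ 3 / 3)).
  + field.
  + intros x; auto_derive; [easy|field].
  + intros x; auto_derive; easy.
- intros l m _; unfold sfun_mult, height; rewrite <- RtoC_mult; f_equal; ring.
- intros x; auto_derive; easy.
Qed.

Lemma powerRZ_m1_opp m : powerRZ (-1) (- m) = powerRZ (-1) m.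
Proof. rewrite powerRZ_neg', <- powerRZ_inv'; f_equal; field. Qed.

(** Of two opposite nonzero orders only the positive one carries a sign. *)
Lemma CS_sign_opp m : m <> 0%Z -> CS_sign m * CS_sign (- m) = powerRZ (-1) m.
Proof.
intros Hm; unfold CS_sign.
destruct (Z.leb_spec 0 m), (Z.leb_spec 0 (- m)); try lia; [ring|].
rewrite powerRZ_m1_opp; ring.
Qed.

Lemma Y_profile_product l m mu : m <> 0%Z -> -1 < mu < 1 ->
  Y_profile l m mu * Y_profile l (- m) mu =
  powerRZ (-1) m * ((2 * INR l + 1) / (4 * PI) *
   (INR (fact (l - Z.abs_nat m)) / INR (fact (l + Z.abs_nat m))))
   / (2 ^ l * INR (fact l)) ^ 2 * ((1 - mu ^ 2) ^ Z.abs_nat m * Rodrigues l (l + Z.abs_nat m) mu ^ 2).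
Proof.
intros Hm Hmu; rewrite <- (CS_sign_opp m Hm).
unfold Y_profile, Y_coef, Legendre_assoc.
replace (Z.abs_nat (- m)) with (Z.abs_nat m) by lia.
fold (Rodrigues l (l + Z.abs_nat m)); set (k := Z.abs_nat m).
assert (F := INR_fact_neq_0 l). assert (P2 : 2 ^ l <> 0) by (apply pow_nonzero; lra).
set (X := (2 * INR l + 1) / (4 * PI) * (INR (fact (l - k)) / INR (fact (l + k)))).
assert (HX : 0 <= X).
{ generalize (INR_fact_lt_0 (l - k)) (INR_fact_lt_0 (l + k)) (pos_INR l) PI_RGT_0; intros.
  unfold X; apply Rmult_le_pos; apply Rlt_le, Rdiv_lt_0_compat; lra. }
assert (H2 := one_minus_sqr_pos mu Hmu).
replace ((1 - mu ^ 2) ^ k) with (sqrt (1 - mu ^ 2) ^ k * sqrt (1 - mu ^ 2) ^ k)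
  by (rewrite <- Rpow_mult_distr, sqrt_sqrt by lra; reflexivity).
(* The two coefficients contain the same square root. *)
rewrite <- (sqrt_sqrt X HX) at 3.
field; split; assumption.
Qed.

Lemma pairing_Y_opp l m : (0 < Z.abs m <= Z.of_nat l)%Z ->
  pairing (Y l m) (Y l (- m)) = RtoC (powerRZ (-1) m).
Proof.
intros Hm; set (k := Z.abs_nat m).
assert (Hk : (k <= l)%nat) by (unfold k; lia).
set (A := powerRZ (-1) m * ((2 * INR l + 1) / (4 * PI) *
   (INR (fact (l - k)) / INR (fact (l + k)))) / (2 ^ l * INR (fact l)) ^ 2).
assert (F := INR_fact_neq_0). assert (P2 : 2 ^ l <> 0) by (apply pow_nonzero; lra).
assert (P0 := PI_RGT_0). assert (L0 := pos_INR l).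
assert (D : forall x, ex_derive (fun mu => (1 - mu ^ 2) ^ k * Rodrigues l (l + k) mu ^ 2) x).
{ intros x; apply ex_derive_mult; [eexists; apply is_derive_weight|].
  apply (ex_derive_pow (fun x => Rodrigues l (l + k) x)), ex_derive_Rodrigues. }
rewrite pairingE.
rewrite (csphere_int_profile _ (fun mu => A * ((1 - mu ^ 2) ^ k * Rodrigues l (l + k) mu ^ 2))).
- f_equal.
  assert (E : RInt (fun mu => A * ((1 - mu ^ 2) ^ k * Rodrigues l (l + k) mu ^ 2)) (-1) 1 = A * Legendre_norm l k).
  { apply (RInt_scal (V := R_CompleteNormedModule)
      (fun mu => (1 - mu ^ 2) ^ k * Rodrigues l (l + k) mu ^ 2)). now apply ex_RInt_of_derive. }
  rewrite E. assert (N := Legendre_normE l k Hk).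
  assert (N' : Legendre_norm l k = 2 * (2 ^ l * INR (fact l)) ^ 2 * INR (fact (l + k))
    / (INR (fact (l - k)) * (2 * INR l + 1))).
  { rewrite <- N; field; split; [lra|apply F]. }
  rewrite N'; unfold A; field; repeat split; try apply F; try assumption; lra.
- intros x mu Hmu; unfold A, k; rewrite <- Y_profile_product by (try assumption; lia).
  unfold sfun_mult, Y. rewrite opp_IZR, Ropp_mult_distr_l_reverse, cos_neg, sin_neg.
  fold (Y_profile l m mu) (Y_profile l (- m) mu).
  unfold Cmult, RtoC; simpl; f_equal; [|ring].
  generalize (sin2_cos2 (IZR m * x)); unfold Rsqr; intros E.
  transitivity (Y_profile l m mu * Y_profile l (- m) mu * (sin (IZR m * x) * sin (IZR m * x) +
     cos (IZR m * x) * cos (IZR m * x))); [ring|rewrite E; ring].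
- intros x; apply ex_derive_scal, D.
Qed.

Lemma Y10_height : sfun_eq (sfun_scal (RtoC (sqrt (4 * PI / 3))) (Y 1 0)) height.
Proof.
intros x mu _; unfold sfun_scal, Y, height.
assert (P0 := PI_RGT_0).
replace (Legendre_assoc 1 (Z.abs_nat 0) mu) with mu.
- rewrite Rmult_0_l, cos_0, sin_0.
  assert (E : sqrt (4 * PI / 3) * Y_coef 1 0 = 1).
  { unfold Y_coef, CS_sign; simpl (0 <=? 0)%Z; simpl powerRZ; rewrite Rmult_1_l, <- sqrt_mult_alt.
    - transitivity (sqrt 1); [f_equal; simpl; field; lra|apply sqrt_1].
    - lra. }
  unfold Cmult, RtoC; simpl; f_equal; [|ring].
  transitivity (sqrt (4 * PI / 3) * Y_coef 1 0 * mu); [ring|rewrite E; ring].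
- unfold Legendre_assoc; simpl.
  rewrite (is_derive_unique _ mu (2 * mu)); [field|].
  auto_derive; [easy|ring].
Qed.

(** * The extended Lie algebra *)

(** The derivative along the parallels, in the form of a bracket. *)
Definition rot (u : sfun) : sfun := poisson u height.

Lemma smooth_rot u : smooth_on_sphere u -> smooth_on_sphere (rot u).
Proof. intros H; exact (smooth_poisson _ _ H smooth_height). Qed.

Lemma poisson_height_l u l m : poisson height u l m = (- rot u l m)%C.
Proof. apply poisson_anti. Qed.

Lemma pairing_height_poisson u v : smooth_on_sphere u -> smooth_on_sphere v ->
  pairing height (poisson u v) = (- pairing (rot u) v)%C.
Proof.
intros Hu Hv; rewrite pairing_poisson by (try apply smooth_height; assumption).
rewrite (pairing_ext _ (sfun_scal (RtoC (-1)) (rot u)) v v);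
 [|intros l m _; rewrite poisson_height_l; unfold sfun_scal; ring|easy].
rewrite pairing_scal_l by (try apply smooth_rot; assumption); ring.
Qed.

Lemma pairing_height_poisson_rot u v : smooth_on_sphere u -> smooth_on_sphere v ->
  pairing height (poisson u v) = pairing u (rot v).
Proof.
intros Hu Hv.
rewrite (pairing_ext height height _ (sfun_scal (RtoC (-1)) (poisson v u)));
 [|easy|intros l m _; rewrite poisson_anti; unfold sfun_scal; ring].
rewrite pairing_scal_r by (try apply smooth_poisson; try apply smooth_height; assumption).
rewrite pairing_height_poisson, (pairing_sym u) by assumption; ring.
Qed.

Lemma pairing_rot u v : smooth_on_sphere u -> smooth_on_sphere v ->
  pairing (rot u) v = (- pairing u (rot v))%C.
Proof.
intros Hu Hv; rewrite <- pairing_height_poisson_rot, pairing_height_poisson by assumption; ring.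
Qed.

Lemma Ceq_opp_0 (z : C) : z = (- z)%C -> z = RtoC 0.
Proof.
intros H; destruct z as (x, y); injection H as Hx Hy; unfold RtoC; f_equal; lra.
Qed.

Lemma pairing_rot_height u : smooth_on_sphere u -> pairing (rot u) height = RtoC 0.
Proof.
intros Hu; assert (Hh := smooth_height). apply Ceq_opp_0.
now rewrite <- pairing_height_poisson, pairing_sym.
Qed.

Section Algebra.
Variables (alpha : R) (G : sgrad_algebra alpha).

Lemma C_scal_m1 (V : ModuleSpace C_Ring) (x : V) : scal (RtoC (-1) : C_Ring) x = opp x.
Proof.
rewrite <- scal_opp_one; f_equal. unfold opp, one; simpl; unfold RtoC, Copp; simpl; f_equal; ring.
Qed.

Lemma sgrad_ext f g : smooth_on_sphere f -> smooth_on_sphere g -> sfun_eq f g ->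
  sgrad G f = sgrad G g.
Proof.
intros Hf Hg E.
(* The difference is zero away from the poles, hence in the kernel of [sgrad]. *)
assert (Z : sgrad G (sfun_plus f (sfun_scal (RtoC (-1)) g)) = zero).
{ apply (sgrad_ker _ G).
  - apply smooth_plus; [exact Hf|now apply smooth_scal].
  - exists (RtoC 0); split; [easy|]; intros l m Hm; unfold sfun_plus, sfun_scal.
    rewrite (E l m Hm); ring. }
rewrite (sgrad_plus _ G), (sgrad_scal _ G), C_scal_m1 in Z by (try apply smooth_scal; assumption).
apply (plus_reg_r (opp (sgrad G g))). etransitivity; [exact Z|symmetry; exact (plus_opp_r (sgrad G g))].
Qed.

(** The elements of the extension, by a stream function and a central component. *)
Definition hat_vec (u : sfun) (s : C) : hat G := (sgrad G u, s).

Lemma hat_vec_surj (X : hat G) : exists u s, smooth_on_sphere u /\ X = hat_vec u s.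
Proof.
destruct X as (x, s); destruct (sgrad_surj _ G x) as (u & Hu & <-); now exists u, s.
Qed.

Lemma hat_vec_ext u v s t : smooth_on_sphere u -> smooth_on_sphere v -> sfun_eq u v -> s = t ->
  hat_vec u s = hat_vec v t.
Proof. intros Hu Hv E ->; unfold hat_vec; now rewrite (sgrad_ext u v). Qed.

Lemma ip_hat_vec u s v t : smooth_on_sphere u -> smooth_on_sphere v ->
  hat_inner G (hat_vec u s) (hat_vec v t) = (pairing (Delta_theta alpha u) v + s * t)%C.
Proof. intros Hu Hv; unfold hat_inner, hat_vec; simpl; now rewrite (sg_innerE _ G). Qed.

(** The inertia operator may be put on either argument. *)
Lemma ip_hat_vec_sym u s v t : smooth_on_sphere u -> smooth_on_sphere v ->
  hat_inner G (hat_vec u s) (hat_vec v t) = (pairing u (Delta_theta alpha v) + s * t)%C.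
Proof. intros Hu Hv; now rewrite ip_hat_vec, pairing_Delta_theta. Qed.

Lemma bracket_hat_vec u s v t : smooth_on_sphere u -> smooth_on_sphere v ->
  hat_bracket G (hat_vec u s) (hat_vec v t) = hat_vec (poisson u v) (pairing height (poisson u v)).
Proof.
intros Hu Hv; unfold hat_bracket, hat_vec; simpl.
now rewrite (sg_bracketE _ G), (sg_OmegaE _ G).
Qed.

Lemma minus_hat_vec u s v t : smooth_on_sphere u -> smooth_on_sphere v ->
  minus (hat_vec u s) (hat_vec v t) = hat_vec (sfun_plus u (sfun_scal (RtoC (-1)) v)) (s - t)%C.
Proof.
intros Hu Hv; unfold hat_vec at 3.
rewrite (sgrad_plus _ G), (sgrad_scal _ G), C_scal_m1 by (try apply smooth_scal; assumption).
reflexivity.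
Qed.

Lemma ip_minus_l X Y Z : hat_inner G (minus X Y) Z = (hat_inner G X Z - hat_inner G Y Z)%C.
Proof.
destruct (hat_vec_surj X) as (u & s & Hu & ->), (hat_vec_surj Y) as (v & t & Hv & ->),
 (hat_vec_surj Z) as (w & r & Hw & ->).
assert (H := smooth_Delta_theta alpha w Hw). assert (Hv' := smooth_scal (RtoC (-1)) v Hv).
rewrite minus_hat_vec, !ip_hat_vec_sym by (try apply smooth_plus; assumption).
rewrite pairing_plus_l, pairing_scal_l by assumption; ring.
Qed.

(** Eigenfunctions of the inertia operator, tested against smooth functions; in
    this form linear combinations are immediate. *)
Definition weak_eigen (c : C) (f : sfun) : Prop :=
  forall g, smooth_on_sphere g -> pairing f (Delta_theta alpha g) = (c * pairing f g)%C.

Lemma weak_eigen_of_eigen c f : smooth_on_sphere f -> sfun_eq (Delta_theta alpha f)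
  (sfun_scal c f) -> weak_eigen c f.
Proof.
intros Hf E g Hg; rewrite <- pairing_Delta_theta by assumption.
rewrite (pairing_ext _ _ g g E) by easy. now apply pairing_scal_l.
Qed.

Lemma weak_eigen_scal c k f : smooth_on_sphere f -> weak_eigen c f ->
  weak_eigen c (sfun_scal k f).
Proof.
intros Hf E g Hg; rewrite !pairing_scal_l by (try apply smooth_Delta_theta; assumption).
rewrite E by assumption; ring.
Qed.

Lemma weak_eigen_plus c f f' : smooth_on_sphere f -> smooth_on_sphere f' -> weak_eigen c f ->
  weak_eigen c f' -> weak_eigen c (sfun_plus f f').
Proof.
intros Hf Hf' E E' g Hg; rewrite !pairing_plus_l by (try apply smooth_Delta_theta; assumption).
rewrite E, E' by assumption; ring.
Qed.

(** Here xi consists of a multiple of the height and a central component, and eta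
    of an eigenfunction [f] whose derivative along the parallels is an eigenfunction
    for the same eigenvalue [c]. *)
Section Curvature.
Variables (nu a : R) (c : C) (f : sfun).
Hypotheses (c_neq0 : c <> RtoC 0) (Hf : smooth_on_sphere f) (Ef : weak_eigen c f)
  (Ef' : weak_eigen c (rot f)).
Variables (nabla : hat G -> hat G -> hat G).
Hypothesis nablaP : hat_connection G nabla.

Let b : C := RtoC (alpha ^ 2 + 2).
Let x : sfun := sfun_scal (RtoC nu) height.
Let xi : hat G := hat_vec x (RtoC a).
Let eta : hat G := hat_vec f (RtoC 0).

Lemma smooth_x : smooth_on_sphere x.
Proof. apply smooth_scal, smooth_height. Qed.

Lemma ip_xi_r u s : smooth_on_sphere u ->
  hat_inner G (hat_vec u s) xi = (RtoC nu * b * pairing u height + s * RtoC a)%C.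
Proof.
intros Hu; assert (Hh := smooth_height).
unfold xi, x; rewrite ip_hat_vec, pairing_scal_r by
  (try apply smooth_scal; try apply smooth_Delta_theta; assumption).
rewrite pairing_Delta_theta by assumption.
rewrite (pairing_ext u u _ (sfun_scal b height) (fun _ _ _ => eq_refl) (Delta_theta_height alpha)).
rewrite pairing_scal_r by assumption; ring.
Qed.

Lemma ip_xi_l u s : smooth_on_sphere u ->
  hat_inner G xi (hat_vec u s) = (RtoC nu * b * pairing u height + s * RtoC a)%C.
Proof.
intros Hu; rewrite <- ip_xi_r by exact Hu; unfold xi; rewrite ip_hat_vec_sym, ip_hat_vec by
 (try apply smooth_x; exact Hu); rewrite pairing_sym; ring.
Qed.

Lemma ip_eig_r u s w : smooth_on_sphere u -> smooth_on_sphere w -> weak_eigen c w ->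
  hat_inner G (hat_vec u s) (hat_vec w (RtoC 0)) = (c * pairing u w)%C.
Proof.
intros Hu Hw E; rewrite ip_hat_vec, pairing_sym, E, (pairing_sym u) by assumption; ring.
Qed.

Lemma ip_eig_l u s w : smooth_on_sphere u -> smooth_on_sphere w -> weak_eigen c w ->
  hat_inner G (hat_vec w (RtoC 0)) (hat_vec u s) = (c * pairing w u)%C.
Proof. intros Hu Hw E; rewrite ip_hat_vec_sym, E by assumption; ring. Qed.

Lemma sfun_eq_poisson_x v : smooth_on_sphere v -> sfun_eq (poisson x v) (sfun_scal (RtoC (- nu))
  (rot v)).
Proof.
intros Hv.
assert (Ex : sfun_eq x (ofR (fun _ m => nu * m))).
{ intros l m _; unfold x, sfun_scal, height, ofR; now rewrite RtoC_mult. }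
apply (sfun_eq_trans _ _ _ (poisson_ext _ _ v v Ex (fun _ _ _ => eq_refl))).
assert (B : forall h, rpoisson (fun _ m => nu * m) h = fun l m => - nu * rd_lambda h l m).
{ intros h; do 2 (apply functional_extensionality; intro); unfold rpoisson.
  replace (rd_lambda (fun _ m => nu * m) x0 x1) with 0 by (symmetry; exact (Derive_const (nu * x1) x0)).
  replace (rd_mu (fun _ m => nu * m) x0 x1) with nu; [ring|].
  unfold rd_mu; rewrite Derive_scal, Derive_id; ring. }
apply sfun_eqE; rewrite re_poisson_ofR, im_poisson_ofR, !B.
unfold rot; rewrite poisson_height.
split; intros l m _; unfold sf_re, sf_im, sfun_scal, d_lambda, CDerive, rd_lambda; simpl; ring.
Qed.

Lemma bracket_xi_l v s : smooth_on_sphere v ->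
  hat_bracket G xi (hat_vec v s) = hat_vec (sfun_scal (RtoC (- nu)) (rot v)) (RtoC 0).
Proof.
intros Hv; assert (Hx := smooth_x). assert (Hr := smooth_rot v Hv). assert (Hh := smooth_height).
unfold xi; rewrite bracket_hat_vec by assumption.
apply hat_vec_ext; [now apply smooth_poisson|now apply smooth_scal|now apply sfun_eq_poisson_x|].
rewrite (pairing_ext _ _ _ _ (fun _ _ _ => eq_refl) (sfun_eq_poisson_x v Hv)).
rewrite pairing_scal_r, pairing_sym, pairing_rot_height by assumption; ring.
Qed.

Lemma bracket_xi_r v s : smooth_on_sphere v ->
  hat_bracket G (hat_vec v s) xi = hat_vec (sfun_scal (RtoC nu) (rot v)) (RtoC 0).
Proof.
intros Hv; assert (Hx := smooth_x). assert (Hr := smooth_rot v Hv). assert (Hh := smooth_height).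
assert (E : sfun_eq (poisson v x) (sfun_scal (RtoC nu) (rot v))).
{ intros l m Hm; rewrite poisson_anti, (sfun_eq_poisson_x v Hv l m Hm); unfold sfun_scal.
  rewrite RtoC_opp; ring. }
unfold xi; rewrite bracket_hat_vec by assumption.
apply hat_vec_ext; [now apply smooth_poisson|now apply smooth_scal|exact E|].
rewrite (pairing_ext _ _ _ _ (fun _ _ _ => eq_refl) E).
rewrite pairing_scal_r, pairing_sym, pairing_rot_height by assumption; ring.
Qed.

(** The inner product of a bracket with xi sees the inertia of the rotation and
    the central component only through their sum. *)
Lemma ip_bracket_xi u s v t : smooth_on_sphere u -> smooth_on_sphere v ->
  hat_inner G (hat_bracket G (hat_vec u s) (hat_vec v t)) xi
  = ((RtoC nu * b + RtoC a) * pairing u (rot v))%C.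
Proof.
intros Hu Hv; rewrite bracket_hat_vec, ip_xi_r by (try apply smooth_poisson; assumption).
rewrite (pairing_sym _ height), pairing_height_poisson_rot by assumption; ring.
Qed.

Let N : C := pairing (rot f) (rot f).

Lemma pairing_rot2 : pairing (rot (rot f)) f = (- N)%C.
Proof. apply pairing_rot; [now apply smooth_rot|exact Hf]. Qed.

Lemma koszul X Y Z : (RtoC 2 * hat_inner G (nabla X Y) Z)%C =
    (hat_inner G (hat_bracket G X Y) Z
     - hat_inner G (hat_bracket G Y Z) X
     + hat_inner G (hat_bracket G Z X) Y)%C.
Proof. apply nablaP. Qed.

Lemma Ceq_half (z w : C) : (RtoC 2 * z)%C = w -> z = (w / RtoC 2)%C.
Proof. intros <-; field. Qed.

(** This holds for every vector, in particular for nabla eta eta, whose value is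
    thus not needed. *)
Lemma curvature_term1 X : hat_inner G (nabla xi X) xi = RtoC 0.
Proof.
destruct (hat_vec_surj X) as (w & s & Hw & ->).
assert (Hr := smooth_rot w Hw). assert (Hh := smooth_height). assert (Hx := smooth_x).
assert (Hrx := smooth_rot x Hx).
rewrite (Ceq_half _ _ (koszul xi (hat_vec w s) xi)).
rewrite bracket_xi_l, bracket_xi_r, !ip_xi_r by (try apply smooth_scal; assumption).
rewrite !pairing_scal_l, pairing_rot_height by assumption.
unfold xi at 1; rewrite bracket_xi_r by exact Hx.
rewrite ip_hat_vec_sym, pairing_scal_l, pairing_rot by
  (try apply smooth_scal; try apply smooth_Delta_theta; assumption).
unfold x; rewrite pairing_scal_l by (try apply smooth_rot; try apply smooth_Delta_theta; assumption).
rewrite (pairing_sym height), pairing_rot_height by (try apply smooth_Delta_theta; assumption).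
field.
Qed.

(** What is needed of the stream function v of nabla xi eta: its pairing with
    the eigenfunction [rot f] is an inner product up to the eigenvalue, and so
    is given by the Koszul formula. *)
Lemma pairing_nabla_xi_eta v s : smooth_on_sphere v -> nabla xi eta = hat_vec v s ->
  pairing v (rot f) = ((RtoC nu * b + RtoC a - RtoC 2 * RtoC nu * c) * N / (RtoC 2 * c))%C.
Proof.
intros Hv E.
assert (Hr := smooth_rot f Hf). assert (Hrr := smooth_rot _ Hr). 
(* The third vector is the eigenfunction against which v is to be paired. *)
assert (K := koszul xi eta (hat_vec (rot f) (RtoC 0))).
rewrite E, ip_eig_r in K by assumption.
unfold eta in K; rewrite ip_bracket_xi, bracket_xi_l, bracket_xi_r in K by assumption.
rewrite !ip_eig_r, !pairing_scal_l, pairing_rot2 in K by (try apply smooth_scal; assumption).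
rewrite (pairing_sym f), pairing_rot2 in K.
fold N in K.
transitivity ((RtoC 2 * (c * pairing v (rot f))) / (RtoC 2 * c))%C; [field; exact c_neq0|].
rewrite K, RtoC_opp; field; exact c_neq0.
Qed.

Lemma curvature_term2 : hat_inner G (nabla eta (nabla xi eta)) xi =
  (- (RtoC nu * b + RtoC a) * (RtoC nu * b + RtoC a - RtoC 2 * RtoC nu * c) * N
   / (RtoC 4 * c))%C.
Proof.
destruct (hat_vec_surj (nabla xi eta)) as (v & s & Hv & E); rewrite E.
assert (Q := pairing_nabla_xi_eta v s Hv E).
assert (Hr := smooth_rot f Hf). assert (Hrv := smooth_rot v Hv).
rewrite (Ceq_half _ _ (koszul eta (hat_vec v s) xi)).
unfold eta; rewrite ip_bracket_xi, bracket_xi_r, bracket_xi_l by assumption.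
rewrite ip_eig_r by (try apply smooth_scal; assumption).
rewrite ip_eig_l by (try apply smooth_scal; try apply weak_eigen_scal; assumption).
rewrite !pairing_scal_l by assumption.
rewrite (pairing_sym (rot v) f), (pairing_sym (rot f) v).
assert (Q' : pairing f (rot v) = (- pairing v (rot f))%C)
  by (rewrite (pairing_sym v), pairing_rot by assumption; ring).
rewrite Q', Q, !RtoC_opp.
replace (RtoC 4) with (RtoC 2 * RtoC 2)%C by (rewrite <- RtoC_mult; f_equal; ring).
field; exact c_neq0.
Qed.

Lemma curvature_term3 : hat_inner G (nabla (hat_bracket G xi eta) eta) xi =
  (- RtoC nu * (RtoC nu * b + RtoC a) * N / RtoC 2)%C.
Proof.
assert (Hr := smooth_rot f Hf).
set (w := sfun_scal (RtoC (- nu)) (rot f)).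
assert (Hw : smooth_on_sphere w) by now apply smooth_scal.
assert (Ew : weak_eigen c w) by now apply weak_eigen_scal.
assert (Hrw := smooth_rot w Hw).
unfold eta; rewrite bracket_xi_l by exact Hf; fold w.
rewrite (Ceq_half _ _ (koszul (hat_vec w (RtoC 0)) (hat_vec f (RtoC 0)) xi)).
rewrite ip_bracket_xi, bracket_xi_r, bracket_xi_l by assumption.
rewrite !ip_eig_r by (try apply smooth_scal; assumption).
rewrite !pairing_scal_l, (pairing_rot w f) by assumption.
unfold w; rewrite pairing_scal_l, pairing_scal_r by assumption; fold N.
rewrite !RtoC_opp; field.
Qed.

(** The three terms add up to a perfect square times N / (4 c). *)
Lemma curvature_xi_eta : hat_inner G (curvature G nabla xi eta eta) xi =
  ((RtoC nu * b + RtoC a) * (RtoC nu * b + RtoC a) * N / (RtoC 4 * c))%C.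
Proof.
unfold curvature; rewrite !ip_minus_l, curvature_term1, curvature_term2, curvature_term3.
replace (RtoC 4) with (RtoC 2 * RtoC 2)%C by (rewrite <- RtoC_mult; f_equal; ring).
field; exact c_neq0.
Qed.

Lemma ip_xi_xi : hat_inner G xi xi = RtoC (nu ^ 2 * (4 * PI / 3) * (alpha ^ 2 + 2) + a ^ 2).
Proof.
assert (Hh := smooth_height).
unfold xi at 1; rewrite ip_xi_r by apply smooth_x.
unfold x; rewrite pairing_scal_l, pairing_height_height by exact Hh; unfold b.
rewrite <- !RtoC_mult, <- RtoC_plus; f_equal; ring.
Qed.

Lemma ip_eta_eta : hat_inner G eta eta = (c * pairing f f)%C.
Proof. now apply ip_eig_r. Qed.

Lemma ip_xi_eta : pairing height f = RtoC 0 -> hat_inner G xi eta = RtoC 0.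
Proof.
intros E; unfold eta; rewrite ip_xi_l, pairing_sym, E by exact Hf; ring.
Qed.

End Curvature.
End Algebra.

(** * Modes of a fixed degree and opposite orders *)

Section Mode.
Variables (l : nat) (m : Z) (p q : C).
Hypothesis m_range : (0 < Z.abs m <= Z.of_nat l)%Z.

(** The stream function of eta. *)
Definition mode : sfun := sfun_plus (sfun_scal p (Y l m)) (sfun_scal q (Y l (- m))).

Let Y1 := smooth_Y l m.
Let Y2 := smooth_Y l (- m).

Lemma smooth_mode : smooth_on_sphere mode.
Proof. apply smooth_plus; now apply smooth_scal. Qed.

Lemma pairing_mode g : smooth_on_sphere g ->
  pairing mode g = (p * pairing (Y l m) g + q * pairing (Y l (- m)) g)%C.
Proof.
intros Hg; unfold mode.
rewrite pairing_plus_l, !pairing_scal_l by (try apply smooth_scal; assumption); reflexivity.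
Qed.

Lemma pairing_rot_Y n g : smooth_on_sphere g -> pairing (Y l n)
  (rot g) = (- (Ci * RtoC (IZR n)) * pairing (Y l n) g)%C.
Proof.
intros Hg; assert (Hn := smooth_Y l n).
transitivity (- pairing (rot (Y l n)) g)%C; [rewrite pairing_rot by assumption; ring|].
unfold rot; rewrite poisson_Y_height, pairing_scal_l by assumption; ring.
Qed.

Lemma pairing_rot_mode g : smooth_on_sphere g -> pairing (rot mode) g =
  (Ci * RtoC (IZR m) * (p * pairing (Y l m) g - q * pairing (Y l (- m)) g))%C.
Proof.
intros Hg; rewrite pairing_rot, pairing_mode, !pairing_rot_Y by
  (try apply smooth_mode; try apply smooth_rot; assumption).
rewrite opp_IZR, RtoC_opp; ring.
Qed.

Let e : C := RtoC (powerRZ (-1) m).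

Lemma pairing_Y_m : pairing (Y l m) (Y l (- m)) = e /\ pairing (Y l (- m)) (Y l m) = e /\
  pairing (Y l m) (Y l m) = RtoC 0 /\ pairing (Y l (- m)) (Y l (- m)) = RtoC 0.
Proof.
rewrite (pairing_sym (Y l (- m)) (Y l m)), (pairing_Y_opp l m m_range).
repeat split; try reflexivity; apply pairing_Y_0; lia.
Qed.

Lemma pairing_mode_mode : pairing mode mode = (RtoC 2 * e * p * q)%C.
Proof.
destruct pairing_Y_m as (A & B & C & D).
rewrite pairing_mode, !(pairing_sym _ mode), !pairing_mode by
  first [apply smooth_mode|assumption].
rewrite A, B, C, D; ring.
Qed.

Lemma pairing_rot_mode_rot_mode : pairing (rot mode)
  (rot mode) = (RtoC (IZR m ^ 2) * pairing mode mode)%C.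
Proof.
assert (H := smooth_mode). assert (H' := smooth_rot mode H).
destruct pairing_Y_m as (A & B & C & D).
rewrite pairing_mode_mode, pairing_rot_mode, !(pairing_sym _ (rot mode)), !pairing_rot_mode by assumption.
rewrite A, B, C, D.
assert (I2 : (Ci * Ci)%C = (- RtoC 1)%C) by (unfold Ci, Cmult, RtoC, Copp; simpl; f_equal; ring).
replace (RtoC (IZR m ^ 2)) with (RtoC (IZR m) * RtoC (IZR m))%C by (rewrite <- RtoC_mult; f_equal; ring).
transitivity (- (RtoC 2) * (Ci * Ci) * (RtoC (IZR m) * RtoC (IZR m)) * (e * p * q))%C;
  [ring|rewrite I2; ring].
Qed.

Lemma weak_eigen_Y alpha n : weak_eigen alpha (RtoC (alpha ^ 2 + INR l * (INR l + 1))) (Y l n).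
Proof. apply weak_eigen_of_eigen; [apply smooth_Y|apply Delta_theta_Y]. Qed.

Lemma weak_eigen_mode alpha : weak_eigen alpha (RtoC (alpha ^ 2 + INR l * (INR l + 1))) mode.
Proof. apply weak_eigen_plus; try apply weak_eigen_scal; try apply smooth_scal; try apply weak_eigen_Y; assumption. Qed.

Lemma weak_eigen_rot_mode alpha : weak_eigen alpha (RtoC (alpha ^ 2 + INR l * (INR l + 1)))
  (rot mode).
Proof.
intros g Hg; rewrite !pairing_rot_mode by (try apply smooth_Delta_theta; assumption).
rewrite !(weak_eigen_Y alpha) by assumption; ring.
Qed.

Lemma pairing_height_mode : pairing height mode = RtoC 0.
Proof.
rewrite pairing_sym, pairing_mode, !(pairing_sym _ height), !pairing_height_Y by
  (try apply smooth_height; lia); ring.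
Qed.

End Mode.

(** * The sectional curvature *)

Theorem mainTheorem3
  (alpha nu a : R) (nu_a_neq0 : (nu, a) <> (0, 0))
  (G : sgrad_algebra alpha)
  (nabla : hat G -> hat G -> hat G) (nablaP : hat_connection G nabla)
  (l0 : nat) (m0 : Z) (l0_ge1 : (1 <= l0)%nat)
  (m0_range : (0 < Z.abs m0 <= Z.of_nat l0)%Z)
  (eta_p eta_m : C) :
  let xi : hat G :=
    (scal (RtoC (nu * sqrt (4 * PI / 3))) (esph G 1 0), RtoC a) in
  let eta : hat G :=
    (plus (scal eta_p (esph G l0 m0)) (scal eta_m (esph G l0 (- m0))), RtoC 0) in
  let c0 : R := alpha ^ 2 + INR l0 * (INR l0 + 1) in
  hat_inner G eta eta = (RtoC (2 * powerRZ (-1) m0 * c0) * eta_p * eta_m)%C /\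
  (hat_inner G eta eta = RtoC 1 ->
   sectional G nabla xi eta
   = (hat_inner G (curvature G nabla xi eta eta) xi / hat_inner G xi xi)%C /\
   (hat_inner G (curvature G nabla xi eta eta) xi / hat_inner G xi xi)%C
   = RtoC (IZR m0 ^ 2
           / ((nu ^ 2 * (4 * PI / 3) * (alpha ^ 2 + 2) + a ^ 2) * c0 ^ 2)
           * (nu ^ 2 / 4 * (alpha ^ 2 + 2) ^ 2
              + nu * a / 2 * (alpha ^ 2 + 2) + a ^ 2 / 4))).
Proof.
intros xi eta c0.
set (f := mode l0 m0 eta_p eta_m).
assert (Hf : smooth_on_sphere f) by apply smooth_mode.
assert (Exi : xi = hat_vec alpha G (sfun_scal (RtoC nu) height) (RtoC a)).
{ unfold xi, esph, hat_vec; f_equal.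
  rewrite <- (sgrad_scal _ G) by apply smooth_Y.
  apply sgrad_ext; try apply smooth_scal; [apply smooth_Y|apply smooth_height|].
  intros x mu Hmu; unfold sfun_scal; rewrite <- (Y10_height x mu Hmu); unfold sfun_scal.
  rewrite RtoC_mult; ring. }
assert (Eeta : eta = hat_vec alpha G f (RtoC 0)).
{ unfold eta, esph, hat_vec, f, mode; f_equal.
  rewrite (sgrad_plus _ G), !(sgrad_scal _ G) by (try apply smooth_scal; apply smooth_Y).
  reflexivity. }
assert (E1 := weak_eigen_mode l0 m0 eta_p eta_m alpha). fold f c0 in E1.
assert (E2 := weak_eigen_rot_mode l0 m0 eta_p eta_m alpha). fold f c0 in E2.
assert (Hc : 0 < c0).
{ assert (1 <= INR l0) by (apply (le_INR 1), l0_ge1). unfold c0; nra. }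
assert (Hc' : RtoC c0 <> RtoC 0) by (intros H; injection H; lra).
rewrite Exi, Eeta; clear xi eta Exi Eeta.
assert (EE := ip_eta_eta alpha G (RtoC c0) f Hf E1).
rewrite EE.
assert (PF := pairing_mode_mode l0 m0 eta_p eta_m m0_range). fold f in PF.
split.
{ rewrite PF, !RtoC_mult; ring. }
intros unit.
set (d := nu ^ 2 * (4 * PI / 3) * (alpha ^ 2 + 2) + a ^ 2).
assert (Hd : 0 < d).
{ unfold d; assert (P0 := PI_RGT_0).
  assert (0 <= nu ^ 2) by apply pow2_ge_0. assert (0 <= a ^ 2) by apply pow2_ge_0.
  assert (0 <= alpha ^ 2) by apply pow2_ge_0.
  destruct (Req_dec nu 0) as [Hn|Hn].
  - assert (a <> 0) by (intros ->; apply nu_a_neq0; now rewrite Hn).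
    assert (0 < a ^ 2) by (apply pow2_gt_0; assumption). 
    assert (0 <= nu ^ 2 * (4 * PI / 3) * (alpha ^ 2 + 2)).
    { apply Rmult_le_pos; [apply Rmult_le_pos|]; lra. }
    lra.
  - assert (0 < nu ^ 2) by (apply pow2_gt_0; assumption).
    assert (0 < nu ^ 2 * (4 * PI / 3) * (alpha ^ 2 + 2)).
    { apply Rmult_lt_0_compat; [apply Rmult_lt_0_compat|]; lra. }
    lra. }
assert (Hd' : RtoC d <> RtoC 0) by (intros H; injection H; lra).
assert (O := ip_xi_eta alpha G nu a f Hf (pairing_height_mode l0 m0 eta_p eta_m m0_range)).
split.
- unfold sectional; rewrite EE, unit, O; f_equal; ring.
- rewrite (curvature_xi_eta alpha G nu a (RtoC c0) f Hc' Hf E1 E2 nabla nablaP), ip_xi_xi.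
  fold d; unfold f; rewrite pairing_rot_mode_rot_mode by exact m0_range; fold f.
  (* The normalisation of eta. *)
  replace (pairing f f) with (RtoC (/ c0)).
  2:{ rewrite RtoC_inv by lra. transitivity (/ RtoC c0 * (RtoC c0 * pairing f f))%C;
      [rewrite unit; ring|field; exact Hc']. }
  rewrite <- !RtoC_mult, <- !RtoC_plus, <- !RtoC_mult, <- !RtoC_div.
  + f_equal; field; lra.
  + lra.
  + lra.
Qed.
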